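(* In the infinite time context, suppose that $A$ and $B$ are semi-decidable sets of reals, with computable injections $f:A\to B$ and $g:B\to A$ whose inverses are computable and whose ranges are decidable. Then there is a computable bijection $h:A\to B$ whose inverse is computable.
   Context: Infinite time Turing machines: three-tape machines with finite programs; successor steps as classically; at limit stages the head returns to the leftmost cell, a special limit state is entered and each cell takes the $\limsup$ of its previous values. Reals are elements of $2^\omega$. A partial function on reals is (infinite time) computable if some program computes it (on its domain); a set of reals is decidable if its characteristic function is computable, and semi-decidable if the partial function with domain the set and constant value $1$ is computable. *)

(* Defs.v *)
From mathcomp Require Import all_boot.
From mathcomp Require Import boolp classical_sets functions wochoice.

Set Implicit Arguments.
Unset Strict Implicit.
Unset Printing Implicit Defensive.

Local Open Scope classical_set_scope.

(* A real is an element of Cantor space; tape contents are reals. *)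
Definition real := nat -> bool.

Definition real0 : real := fun=> false.

(* The number 1 is coded by 1000..., just as 0 is coded by 0000... *)
Definition real1 : real := fun n => n == 0.

(* The bits on the input, scratch and output tapes under the head. *)
Definition symbol : Type := bool * bool * bool.

Inductive direction := MoveLeft | MoveRight.

Record program := Program {
  states : finType;
  start_state : states;
  halt_state : states;
  limit_state : states;
  states_uniq : uniq [:: start_state; halt_state; limit_state];
  (* The value at halt_state is irrelevant: see [outputs]. *)
  delta : states -> symbol -> states * symbol * direction
}.

(* One head scans the same position of the three tapes. *)
Record config (Q : Type) := Config {
  state : Q;
  head : nat;
  input_tape : real;
  scratch_tape : real;
  output_tape : real
}.

Section Computation.
Variable p : program.
Implicit Types (c : config (states p)).

Definition start_config (x : real) : config (states p) :=
  Config (start_state p) 0 x real0 real0.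

(* A left move from the leftmost cell leaves the head in place. *)
Definition move_head (d : direction) (i : nat) : nat :=
  match d with MoveLeft => i.-1 | MoveRight => i.+1 end.

Definition write (t : real) (i : nat) (b : bool) : real := [eta t with i |-> b].

Definition step c : config (states p) :=
  let i := head c in
  let: (q, (a1, a2, a3), d) :=
    delta (state c) (input_tape c i, scratch_tape c i, output_tape c i) in
  Config q (move_head d i)
    (write (input_tape c) i a1)
    (write (scratch_tape c) i a2)
    (write (output_tape c) i a3).

(* Ordinal stages are the points of a type W well-ordered by R (the reflexive
   order relation), so that u < v is ~~ R v u. *)
Section Stages.
Variables (W : Type) (R : rel W).

Definition before (u v : W) : bool := ~~ R v u.

Definition zero_stage (w : W) : Prop := forall u, R w u.

Definition succ_stage (v w : W) : Prop :=
  before v w /\ forall u, before u w -> R u v.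

Definition limit_stage (w : W) : Prop :=
  (exists v, before v w) /\
  forall v, before v w -> exists2 u, before v u & before u w.

(* The limsup of the bits t v, v < w, that is, the infimum over u < w of the
   suprema over u <= v < w of t v, computed cell by cell. *)
Definition limsup_tape (t : W -> real) (w : W) : real := fun n =>
  `[< forall u, before u w -> exists v, [/\ R u v, before v w & t v n] >].

Definition limit_config (c : W -> config (states p)) (w : W) :
    config (states p) :=
  Config (limit_state p) 0
    (limsup_tape (fun v => input_tape (c v)) w)
    (limsup_tape (fun v => scratch_tape (c v)) w)
    (limsup_tape (fun v => output_tape (c v)) w).

Definition is_run (x : real) (c : W -> config (states p)) : Prop :=
  [/\ forall w, zero_stage w -> c w = start_config x,
      forall v w, succ_stage v w -> c w = step (c v)
    & forall w, limit_stage w -> c w = limit_config c w].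

(* The configurations at stages after the first halting one play no role. *)
Definition halts_at (c : W -> config (states p)) (w : W) : Prop :=
  state (c w) = halt_state p /\
  forall v, before v w -> state (c v) <> halt_state p.

End Stages.

Definition outputs (x y : real) : Prop :=
  exists (W : Type) (R : rel W) (c : W -> config (states p)) (w : W),
    [/\ well_order R, is_run R x c, halts_at R c w & output_tape (c w) = y].

End Computation.

(* Partial functions on the reals are represented by their graphs. *)
Definition graph (A : set real) (f : real -> real) : real -> real -> Prop :=
  fun x y => A x /\ f x = y.

Definition graph_inv (F : real -> real -> Prop) : real -> real -> Prop :=
  fun y x => F x y.

(* The program halts exactly on the domain of F. *)
Definition computable (F : real -> real -> Prop) : Prop :=
  exists p : program, forall x y, F x y <-> outputs p x y.

Definition char_fun (A : set real) (x : real) : real :=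
  if x \in A then real1 else real0.

Definition decidable_set (A : set real) : Prop :=
  computable (graph setT (char_fun A)).

Definition semi_decidable_set (A : set real) : Prop :=
  computable (graph A (fun=> real1)).

(* Main.v *)
(* The Cantor-Schroeder-Bernstein bijection sends x to g^-1(x) if the chain of
   preimages x, g^-1(x), f^-1(g^-1(x)), ... stops in B, and to f(x) otherwise.
   A machine follows this chain back, which takes omega rounds if the chain is
   infinite. It recognizes the limit of the rounds by a cell that is set and
   then cleared in each round: the limsup makes this cell 1 there, while at the
   limits inside a single round it is 0.
   Programs have only three tapes, all of which the subroutines use, so this
   machine is first described with any finite number of tracks. To run it on
   three tapes, the input is spread out so that cell n becomes a block of
   cells holding the tracks at n, and the output is gathered again at the end.
   Simulations preserve limits because each simulated cell has its own cell, in
   which nothing but the simulated values is ever written. *)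
Require Import Defs.
From HB Require Import structures.
From mathcomp Require Import all_boot.
From mathcomp Require Import boolp classical_sets functions wochoice.

Set Implicit Arguments.
Unset Strict Implicit.
Unset Printing Implicit Defensive.

Local Open Scope classical_set_scope.

(** * Well-orders *)

(** An output is defined by the existence of a run over some well-ordered type, so runs are handled
    as segments over varying orders. Segments are concatenated along lexicographic sums, and two
    runs of one machine are compared by matching their stages, which makes outputs unique. No single
    segment shows that a machine never halts. Divergence therefore asks for halting-free segments at
    least as long as any given order; simulations preserve this, and comparison of runs shows that
    it excludes halting. A limit stage destroys the state and the head position, so what comes next
    can only be read off cell 0. Each machine keeps a record of its current phase there, constant
    during the phase, and its working marks recede to infinity so that the limit erases them. Only
    at the limit of an endless chain, where several phases recur, is this record ambiguous. A
    program must also diverge off its domain. Membership in the ranges is decidable, so every test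
    on the chain returns, and divergence is left to a preliminary call of the program that
    semi-decides A or B. *)

Section WellOrder.
Variables (W : Type) (R : rel W).
Hypothesis Rwo : well_order R.

Lemma wo_min (P : W -> Prop) :
  (exists u, P u) -> exists2 m, P m & forall u, P u -> R m u.
Proof.
move=> [u Pu]; have [|m [[/asboolP Pm mP] _]] := Rwo (A := fun u => `[<P u>]).
  by exists u; apply/asboolP.
by exists m => // v Pv; apply: mP; apply/asboolP.
Qed.

Lemma wo_refl u : R u u.
Proof.
by have [|m -> /(_ u erefl)] := @wo_min (fun v => v = u); first exists u.
Qed.

(** Minima of nonempty sets are unique, and both [u] and [v] are minima of the set {u, v}. *)
Lemma wo_anti u v : R u v -> R v u -> u = v.
Proof.
move=> uv vu; have [|m [_ mu]] := Rwo (A := fun w => `[<w = u \/ w = v>]).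
  by exists u; apply/asboolP; left.
have <- : m = u.
  apply: mu; split; first by apply/asboolP; left.
  by move=> w /asboolP[]->; rewrite ?wo_refl.
apply: mu; split; first by apply/asboolP; right.
by move=> w /asboolP[]->; rewrite ?wo_refl.
Qed.

Lemma wo_trans v u w : R u v -> R v w -> R u w.
Proof.
move=> uv vw; have [|m mP mle] := @wo_min (fun x => [\/ x = u, x = v | x = w]).
  by exists u; apply: Or31.
have [mu mv mw] : [/\ R m u, R m v & R m w].
  by split; apply: mle; [apply: Or31|apply: Or32|apply: Or33].
case: mP => E; subst m => //; first by rewrite (wo_anti uv mu).
by rewrite -(wo_anti vw mv).
Qed.

Lemma wo_total u v : R u v \/ R v u.
Proof.
have [|m mP mle] := @wo_min (fun x => x = u \/ x = v); first by exists u; left.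
by case: mP => <-; [left|right]; apply: mle; [right|left].
Qed.

Lemma before_le u v : before R u v -> R u v.
Proof. by case: (wo_total u v) => // vu /negP. Qed.

Lemma before_irr u : ~ before R u u.
Proof. by rewrite /before wo_refl. Qed.

Lemma before_le_trans v u w : before R u v -> R v w -> before R u w.
Proof. by move=> /negP uv vw; apply/negP => wu; apply: uv; apply: wo_trans wu. Qed.

Lemma le_before_trans v u w : R u v -> before R v w -> before R u w.
Proof. by move=> uv /negP vw; apply/negP => wu; apply: vw; apply: wo_trans uv. Qed.

Lemma before_trans v u w : before R u v -> before R v w -> before R u w.
Proof. by move=> uv /before_le; apply: before_le_trans. Qed.

Lemma le_eq_before u v : R u v -> u = v \/ before R u v.
Proof.
by move=> uv; case: (boolP (R v u)) => [vu|]; [left; apply: wo_anti|right].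
Qed.

Lemma wo_ind (P : W -> Prop) :
  (forall v, (forall u, before R u v -> P u) -> P v) -> forall v, P v.
Proof.
move=> IH v; apply: contrapT => nPv.
have [|m nPm mle] := @wo_min (fun u => ~ P u); first by exists v.
apply: nPm; apply: IH => u um; apply: contrapT => /mle mu.
by rewrite /before mu in um.
Qed.

Lemma wo_acc : well_founded (fun u v => before R u v).
Proof. by apply: wo_ind => v IH; constructor. Qed.

End WellOrder.

(** * Transfinite runs *)

(* [bit c] lists the cells of the tapes of [c]; [lim f] is the configuration
   entered at a limit stage at which the cells have limsup [f]. *)
Record system := System {
  conf : Type;
  idx : Type;
  next_conf : conf -> conf;
  bit : conf -> idx -> bool;
  lim : (idx -> bool) -> conf
}.

Section Runs.
Variable S : system.
Implicit Types (c d : conf S).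

Section OneOrder.
Variables (W : Type) (R : rel W) (b : W -> conf S).
Implicit Types D X : W -> Prop.

Definition limit_set D :=
  (exists u, D u) /\ forall u, D u -> exists2 v, D v & before R u v.

Definition limsup_bit D (j : idx S) : bool :=
  `[< forall u, D u -> exists v, [/\ D v, R u v & bit (b v) j] >].

(* [follows c0 D c]: c is the configuration that follows the stages in D, where
   c0 is the configuration at the first stage. *)
Inductive follows c0 D : conf S -> Prop :=
| follows_zero : (forall u, ~ D u) -> follows c0 D c0
| follows_succ m : D m -> (forall u, D u -> R u m) -> follows c0 D (next_conf (b m))
| follows_limit : limit_set D -> follows c0 D (lim (limsup_bit D)).

(** The stages form a subset [X] of the order so that a proper initial part of a run is a run over
    the same type. *)
Definition run c0 X :=
  forall w, X w -> follows c0 (fun u => X u /\ before R u w) (b w).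

Lemma eq_follows c0 D D' c : (forall u, D u <-> D' u) ->
  follows c0 D c -> follows c0 D' c.
Proof. by move=> DD'; rewrite (_ : D = D') //; apply/predeqP. Qed.

Hypothesis Rwo : well_order R.

Lemma follows_exists c0 D : exists c, follows c0 D c.
Proof.
have [D0|/existsNP[u /contrapT Du]] := pselect (forall u, ~ D u).
  by exists c0; constructor.
have [[m Dm mle]|nomax] := pselect (exists2 m, D m & forall u, D u -> R u m).
  by exists (next_conf (b m)); apply: follows_succ.
exists (lim (limsup_bit D)); apply: follows_limit; split; first by exists u.
move=> v Dv; apply: contrapT => nv; apply: nomax; exists v => // w Dw.
by apply: contrapT => /negP wv; apply: nv; exists w.
Qed.

Lemma follows_max c0 D m c : D m -> (forall u, D u -> R u m) ->
  follows c0 D c -> c = next_conf (b m).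
Proof.
move=> Dm mle; case=> [/(_ m)//|m' Dm' m'le|[_ /(_ m Dm)[v Dv]]].
  by rewrite (wo_anti Rwo (mle m' Dm') (m'le m Dm)).
by rewrite /before mle.
Qed.

Lemma follows_first c0 D c : (forall u, ~ D u) -> follows c0 D c -> c = c0.
Proof. by move=> D0; case=> // [m /D0|[[u /D0]]]. Qed.

Lemma follows_at_limit c0 D c : limit_set D -> follows c0 D c ->
  c = lim (limsup_bit D).
Proof.
move=> [[u Du] Dl]; case=> // [/(_ u)//|m Dm mle].
by have [v Dv] := Dl m Dm; rewrite /before mle.
Qed.

Lemma run_succ c0 X v : run c0 X -> X v -> (exists2 w, X w & before R v w) ->
  exists w, [/\ X w, before R v w, b w = next_conf (b v)
    & forall u, X u -> before R v u -> R w u].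
Proof.
move=> Xrun Xv [w Xw vw].
have [|m [Xm vm] mle] := wo_min Rwo (P := fun u => X u /\ before R v u).
  by exists w.
exists m; split=> // [|u Xu vu]; last exact: mle.
apply: follows_max (Xrun m Xm) => // u [Xu um].
by apply: contrapT => /negP vu; move: um; rewrite /before mle.
Qed.

End OneOrder.

Lemma eq_follows_run (W : Type) (R : rel W) (b b' : W -> conf S) c0 D c :
  (forall u, D u -> b u = b' u) -> follows R b c0 D c -> follows R b' c0 D c.
Proof.
move=> bb'; case=> [D0|m Dm mle|Dl]; first exact: follows_zero.
  by rewrite bb' //; apply: follows_succ.
have -> : limsup_bit R b D = limsup_bit R b' D; last exact: follows_limit.
apply/funext => j; apply: asbool_equiv_eq; split=> H u /H[v [Dv uv bv]];
  by exists v; rewrite ?bb' // -?bb'.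
Qed.

Lemma run_exists (W : Type) (R : rel W) c0 : well_order R ->
  exists b, run R b c0 (fun=> True).
Proof.
move=> Rwo.
(* [follows] consults only the stages before [w], so [rec] may be completed arbitrarily
   elsewhere. *)
pose F w (rec : forall u, before R u w -> conf S) :=
  sval (cid (@follows_exists W R
    (fun u => if pselect (before R u w) is left uw then rec u uw else c0)
    c0 (fun u => before R u w))).
pose b := Fix (wo_acc Rwo) (fun=> conf S) F.
exists b => w _; rewrite /b Fix_eq => [|v f g fg]; last first.
  congr (F v); apply: functional_extensionality_dep => u.
  by apply: functional_extensionality_dep => uv.
rewrite -/b /F; case: cid => c /= cP.
apply: (@eq_follows _ _ _ _ (fun u => before R u w)); first by move=> u; split=> // -[].
apply: eq_follows_run cP => u uw; case: pselect => // uw'.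
Qed.

(** * Lexicographic sums of runs *)

Section SumOrder.
Variables (V : Type) (RV : rel V).
Variables (W : V -> Type) (R : forall v, rel (W v)).
Hypothesis Vwo : well_order RV.
Hypothesis Wwo : forall v, well_order (@R v).

Definition lex (s t : {v & W v}) : bool :=
  `[< before RV (projT1 s) (projT1 t) \/
      exists e : projT1 s = projT1 t,
        R (ecast v (W v) e (projT2 s)) (projT2 t) >].

Lemma lexE v u u' : lex (existT W v u) (existT W v u') = R u u'.
Proof.
apply/asboolP/idP => /= [[/(before_irr Vwo)//|[e]]|uu'].
  by rewrite (Prop_irrelevance e erefl).
by right; exists erefl.
Qed.

Lemma lex_before v u v' u' :
  before RV v v' -> before lex (existT W v u) (existT W v' u').
Proof.
move=> vv'; apply/asboolP => /= -[|[e _]].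
  by move/(before_trans Vwo vv')/(before_irr Vwo).
by move: vv'; rewrite e; apply: before_irr.
Qed.

Lemma lex_beforeE v u u' :
  before lex (existT W v u) (existT W v u') = before (@R v) u u'.
Proof. by rewrite /before lexE. Qed.

Lemma lex_le_tag s t : lex s t -> RV (projT1 s) (projT1 t).
Proof.
by case/asboolP => [/(before_le Vwo)//|[e _]]; rewrite e; apply: wo_refl.
Qed.

Lemma before_lex_tag s t : before lex s t -> RV (projT1 s) (projT1 t).
Proof.
move=> st; apply: contrapT => /negP ts; move/negP: st; apply.
by apply/asboolP; left.
Qed.

Lemma lex_wo : well_order lex.
Proof.
apply: antisymmetric_well_order.
  move=> [v u] [v' u'] /andP[st ts].
  have e : v = v'.
    exact: wo_anti Vwo _ _ (lex_le_tag st) (lex_le_tag ts).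
  move: u' st ts; case: v' / e => u'; rewrite !lexE => st ts.
  by rewrite (wo_anti (@Wwo v) st ts).
move=> A [[v0 u0] A0].
have [|v [u Avu] vle] := wo_min Vwo (P := fun v => exists u, existT W v u \in A).
  by exists v0, u0.
have [|m Am mle] := wo_min (@Wwo v) (P := fun u => existT W v u \in A).
  by exists u.
exists (existT W v m); split=> // -[v' u'] Au'.
have [|e|vv'] := le_eq_before Vwo (u := v) (v := v'); first by apply: vle; exists u'.
  by move: u' Au'; case: v' / e => u' Au'; rewrite lexE mle.
by apply/asboolP; left.
Qed.

Variables (b : forall v, W v -> conf S) (E : V -> conf S) (c0 : conf S).
Variables (XV : V -> Prop) (X : forall v, W v -> Prop).

Definition sum_stages (s : {v & W v}) : Prop := XV (projT1 s) /\ X (projT2 s).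
Definition sum_run (s : {v & W v}) : conf S := b (projT2 s).

(** The stages of [D] outside fibre [v] precede all of [D'], so [D'] is cofinal in [D]. Having a
    last stage, being a limit and the limsup depend only on a cofinal part. *)
Lemma follows_sum v (D : {v & W v} -> Prop) (D' : W v -> Prop) c :
    (exists u, D' u) -> (forall u, D' u -> D (existT W v u)) ->
    (forall s, D s -> before RV (projT1 s) v \/
       exists2 u, D' u & s = existT W v u) ->
  follows (@R v) (@b v) (E v) D' c -> follows lex sum_run c0 D c.
Proof.
move=> D'n D'D DD'; case=> [D0|m Dm mle|Dl]; first by case: D'n => u /D0.
  apply: (@follows_succ _ _ _ _ _ (existT W v m)); first exact: D'D.
  case=> v' u' /DD'[/= vv'|[u D'u ->]]; last by rewrite lexE mle.
  exact: before_le lex_wo _ _ (lex_before _ _ vv').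
have lowD s : D s -> exists2 u, D' u & lex s (existT W v u).
  case: s => v' u' /DD'[/= vv'|[u D'u ->]].
    case: D'n => u D'u; exists u => //.
    exact: before_le lex_wo _ _ (lex_before _ _ vv').
  by exists u => //; rewrite lexE wo_refl.
have -> : limsup_bit (@R v) (@b v) D' = limsup_bit lex sum_run D.
  apply/funext => j; apply: asbool_equiv_eq; split=> H.
    move=> s /lowD[u /H[w [D'w uw bw]] su]; exists (existT W v w).
    split=> //; first exact: D'D.
    by apply: (wo_trans lex_wo su); rewrite lexE.
  move=> u D'u; have [[v' w] [Dw uw bw]] := H _ (D'D _ D'u).
  case: (DD' _ Dw) => [/= v'v|[u' D'u' e]].
    by move: (lex_le_tag uw) => /=; move/negP: v'v.
  exists u'; split=> //; first by rewrite -lexE -e.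
  by rewrite e in bw.
apply: follows_limit; split; first by case: D'n => u /D'D; exists (existT W v u).
move=> s /lowD[u D'u su]; have [w D'w uw] := Dl.2 u D'u.
exists (existT W v w); first exact: D'D.
by apply: (le_before_trans lex_wo su); rewrite lex_beforeE.
Qed.

Hypothesis Xn : forall v, XV v -> exists u : W v, X u.
Hypothesis Xrun : forall v, XV v -> run (@R v) (@b v) (E v) (@X v).

(** A stage with predecessors in its own fibre is settled by [follows_sum]. At the first stage of
    fibre [v] the hypothesis says that [E v] follows all earlier fibres. *)
Lemma run_sum :
  (forall v, XV v ->
     follows lex sum_run c0
       (fun s => sum_stages s /\ before RV (projT1 s) v) (E v)) ->
  run lex sum_run c0 sum_stages.
Proof.
move=> HE [v u] [/= Xv Xu].
have bel s : sum_stages s /\ before lex s (existT W v u) ->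
    before RV (projT1 s) v \/
    exists2 u', X u' /\ before (@R v) u' u & s = existT W v u'.
  case: s => v' u' [[/= Xv' Xu'] s_lt].
  have [e|] := le_eq_before Vwo (before_lex_tag s_lt); last by left.
  move: e => /= e; subst v'; right; exists u' => //; split=> //.
  by rewrite lex_beforeE in s_lt.
have [D0|/existsNP[u' /contrapT Du']] :=
    pselect (forall u', ~ (X u' /\ before (@R v) u' u)).
  rewrite /sum_run /= (follows_first D0 (Xrun Xv Xu)).
  apply: eq_follows (HE v Xv) => s; split=> [[Xs sv]|Hs].
    by split=> //; case: s Xs sv => v' u' _; apply: lex_before.
  split; first by case: Hs.
  by case: (bel s Hs) => // -[u' Du' _]; case: (D0 u').
apply: (follows_sum _ _ bel (Xrun Xv Xu)); first by exists u'.
by move=> w [Xw wu]; split; rewrite ?lex_beforeE.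
Qed.

End SumOrder.

Record segment_data := SegmentData {
  seg_type : Type;
  seg_rel : rel seg_type;
  seg_conf : seg_type -> conf S;
  seg_stages : seg_type -> Prop
}.

Definition is_segment (P : conf S -> Prop) c c' (s : segment_data) : Prop :=
  [/\ exists u, @seg_stages s u,
      run (@seg_rel s) (@seg_conf s) c (@seg_stages s),
      forall u, seg_stages u -> P (@seg_conf s u)
    & follows (@seg_rel s) (@seg_conf s) c (@seg_stages s) c'].

(* The stages visited, at least one, include c but not c'. *)
Definition leads (P : conf S -> Prop) c c' : Prop :=
  exists2 s : segment_data, well_order (@seg_rel s) & is_segment P c c' s.

Lemma leadsW (P Q : conf S -> Prop) c c' :
  (forall d, P d -> Q d) -> leads P c c' -> leads Q c c'.
Proof.
by move=> PQ [s swo [sn srun sP snext]]; exists s => //; split=> // u /sP/PQ.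
Qed.

Lemma run_first (W : Type) (R : rel W) (b : W -> conf S) c X :
    well_order R -> run R b c X -> (exists u, X u) ->
  exists m, [/\ X m, b m = c & forall u, X u -> R m u].
Proof.
move=> Rwo Xrun Xn; have [m Xm mle] := wo_min Rwo Xn; exists m; split=> //.
apply: (follows_first _ (Xrun m Xm)) => u [Xu].
by rewrite /before mle.
Qed.

Lemma leads_start P c c' : leads P c c' -> P c.
Proof.
move=> [s swo [sn srun sP _]].
by have [m [Xm <- _]] := run_first swo srun sn; apply: sP.
Qed.

Lemma unit_wo : well_order (fun _ _ : unit => true).
Proof. by apply: antisymmetric_well_order => [[] []//|A [[] A0]]; exists tt. Qed.

Lemma leads_step (P : conf S -> Prop) c : P c -> leads P c (next_conf c).
Proof.
move=> Pc.
exists (@SegmentData unit (fun _ _ => true) (fun=> c) (fun=> True)) => /=.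
  exact: unit_wo.
split=> /=; [by exists tt| |by []|exact: (@follows_succ _ _ _ _ _ tt)].
by move=> [] _; apply: follows_zero => -[] [].
Qed.

Lemma segment_family (V : Type) (X : V -> Prop) (P : V -> conf S -> Prop)
    (c c' : V -> conf S) :
    (forall v, X v -> leads (P v) (c v) (c' v)) ->
  exists F : V -> segment_data, (forall v, well_order (@seg_rel (F v))) /\
    forall v, X v -> is_segment (P v) (c v) (c' v) (F v).
Proof.
move=> H; have [v|F FP] := @choice _ _ (fun v (s : segment_data) =>
    well_order (@seg_rel s) /\ (X v -> is_segment (P v) (c v) (c' v) s)).
  have [Xv|nXv] := pselect (X v); first by have [s] := H v Xv; exists s.
  (* A dummy: choice needs a segment over a well-order for every index. *)
  exists (@SegmentData unit (fun _ _ => true) (fun=> c v) (fun=> True)).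
  by split=> //; apply: unit_wo.
by exists F; split=> v; case: (FP v).
Qed.

Lemma leq_wo : well_order leq.
Proof.
apply: antisymmetric_well_order => [|A [n An]]; first exact: anti_leq.
have exA : exists n, n \in A by exists n.
by exists (ex_minn exA); case: ex_minnP => m Am mle; split.
Qed.

Section Omega.
Variables (P : nat -> conf S -> Prop) (s : nat -> conf S).
Hypothesis Ps : forall n, leads (P n) (s n) (s n.+1).

(** The last two clauses extract from the limsup what later proofs use: cells that settle through
    whole rounds, and cells that are 1 at the start of infinitely many rounds. *)
Lemma leads_omega :
  exists f : idx S -> bool,
  [/\ leads (fun d => exists n, P n d) (s 0) (lim f),
      forall j a, (exists N, forall n, N <= n -> forall d, P n d -> bit d j = a) ->
        f j = a
    & forall j, (forall N, exists2 n, N <= n & bit (s n) j) -> f j].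
Proof.
have [F [Fwo FP]] := @segment_family _ (fun=> True) _ _ _ (fun n _ => Ps n).
pose W n := seg_type (F n); pose R n := @seg_rel (F n).
pose b n := @seg_conf (F n); pose X n := @seg_stages (F n).
have Xn n : True -> exists u : W n, X n u by move=> _; case: (FP n I).
have Xrun n : True -> run (R n) (b n) (s n) (X n) by move=> _; case: (FP n I).
have lwo := lex_wo leq_wo Fwo.
pose ST := sum_stages (fun=> True) X; pose B := sum_run b.
have STlim : limit_set (lex leq R) ST.
  split; first by have [u Xu] := Xn 0 I; exists (existT W 0 u).
  case=> n u _; have [u' Xu'] := Xn n.+1 I; exists (existT W n.+1 u') => //.
  by apply: (lex_before _ leq_wo); rewrite /before -ltnNge.
exists (limsup_bit (lex leq R) B ST); split.
- exists (SegmentData (lex leq R) B ST) => //=; split=> //=.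
  + by have [u Xu] := Xn 0 I; exists (existT W 0 u).
  + apply: (run_sum leq_wo Fwo Xrun).
    case=> [|n] _; first by apply: follows_zero => -[n u] [_]; rewrite /before.
    apply: (@follows_sum _ _ _ _ leq_wo Fwo _ s _ n _ (X n)) (Xn n I) _ _ _.
    * move=> u Xu.
      by split=> //=; rewrite /before ltnn.
    * move=> [v u] [[/= _ Xu]]; rewrite /before -ltnNge ltnS /= leq_eqVlt.
      case/orP => [/eqP e|vn]; last by left; rewrite -ltnNge.
      by subst v; right; exists u.
    * by case: (FP n I).
  + by case=> n u [_ Xu]; exists n; case: (FP n I) => _ _ + _; apply.
  + exact: follows_limit.
- move=> j a [N HN].
  have bitN n (u : W n) : N <= n -> X n u -> bit (b n u) j = a.
    by move=> Nn Xu; apply: (HN n) => //; case: (FP n I) => _ _ + _; apply.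
  have [uN XuN] := Xn N I.
  apply/asboolP/idP => [|Ha].
    move/(_ (existT W N uN) (conj I XuN)) => [[n u] [[_ /= Xu] Nn bu]].
    by rewrite -(bitN n u) //; apply: (lex_le_tag leq_wo Nn).
  (* The witness must lie past round [n], and not before round [N], from which on the cell is
     constant. *)
  case=> n u _; have [u' Xu'] := Xn (maxn N n.+1) I.
  exists (existT W (maxn N n.+1) u'); split=> //.
    apply: (before_le lwo); apply: (lex_before _ leq_wo).
    by rewrite /before -ltnNge leq_max ltnSn orbT.
  by rewrite /B /sum_run /= bitN ?leq_maxl.
- move=> j Hj; apply/asboolP => -[n u] _; have [m nm bm] := Hj n.+1.
  have [u' [Xu' bu' _]] := run_first (Fwo m) (Xrun m I) (Xn m I).
  exists (existT W m u'); split=> //.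
    apply: (before_le lwo); apply: (lex_before _ leq_wo).
    by rewrite /before -ltnNge.
  by rewrite /B /sum_run /= bu'.
Qed.

End Omega.

End Runs.

(** On booleans [implb] is the order false < true, along which two segments are concatenated. *)
Lemma implb_wo : well_order implb.
Proof.
apply: antisymmetric_well_order => [[] []//|A [v Av]].
case: (boolP (false \in A)) => A0; first by exists false.
exists true; split=> [|[]//]; first by case: v Av A0 => // ->.
by move=> A0'; rewrite A0' in A0.
Qed.

(** * Halting and divergence *)

Section Runs.
Variable S : system.
Implicit Types (c d : conf S) (P halted : conf S -> Prop).

(** [Phi] is strictly increasing, so the segment is at least as long as [RV]; a relation avoids
    choosing one stage for each point. *)
Definition long (V : Type) (RV : rel V) (s : segment_data S) : Prop :=
  exists Phi : V -> seg_type s -> Prop,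
    (forall v, exists2 t, seg_stages t & Phi v t) /\
    forall u v t t', before RV u v -> Phi u t -> Phi v t' ->
      before (@seg_rel _ s) t t'.

Definition halts halted c c' : Prop :=
  leads (fun d => ~ halted d) c c' /\ halted c'.

(* Quantifying over arbitrarily long orders avoids runs indexed by the proper
   class of all ordinals. *)
Definition diverges halted c : Prop :=
  forall (V : Type) (RV : rel V), well_order RV -> (exists v : V, True) ->
  exists s c', [/\ well_order (@seg_rel _ s),
    is_segment (fun d => ~ halted d) c c' s, ~ halted c' & long RV s].

Section Concatenation.
Variables (P : conf S -> Prop) (c c' c'' : conf S) (s1 s2 : segment_data S).
Hypothesis (wo1 : well_order (@seg_rel _ s1)) (wo2 : well_order (@seg_rel _ s2)).
Hypothesis (seg1 : is_segment P c c' s1) (seg2 : is_segment P c' c'' s2).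

Let F (v : bool) : segment_data S := if v then s2 else s1.

Definition cat_segment : segment_data S :=
  SegmentData (lex implb (fun v => @seg_rel _ (F v)))
    (sum_run (fun v => @seg_conf _ (F v)))
    (sum_stages (fun=> True) (fun v => @seg_stages _ (F v))).

Let Fwo v : well_order (@seg_rel _ (F v)). Proof. by case: v. Qed.

Lemma cat_segment_wo : well_order (@seg_rel _ cat_segment).
Proof. exact: lex_wo implb_wo Fwo. Qed.

Lemma cat_segmentP : is_segment P c c'' cat_segment.
Proof.
have [[u1 Xu1] run1 P1 next1] := seg1; have [[u2 Xu2] run2 P2 next2] := seg2.
have Frun v : True -> run (@seg_rel _ (F v)) (@seg_conf _ (F v))
    (if v then c' else c) (@seg_stages _ (F v)) by case: v.
split.
- by exists (existT (fun v => seg_type (F v)) true u2).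
- apply: (run_sum implb_wo Fwo Frun) => -[] _; last first.
    by apply: follows_zero => -[v u] [_]; rewrite /before; case: v u.
  apply: (@follows_sum _ _ _ _ _ implb_wo Fwo _ (fun v => if v then c' else c)
    c false _ (@seg_stages _ s1)) next1.
  + by exists u1.
  + by move=> u Xu; split.
  + by case=> -[] u [[_ /= Xu]] // _; right; exists u.
- by case=> -[] u [_ Xu]; [apply: P2|apply: P1].
- apply: (@follows_sum _ _ _ _ _ implb_wo Fwo _ (fun v => if v then c' else c)
    c true _ (@seg_stages _ s2)) next2.
  + by exists u2.
  + by move=> u Xu; split.
  + by case=> -[] u [_ /= Xu]; [right; exists u|left].
Qed.

Lemma cat_segment_long (V : Type) (RV : rel V) :
  long RV s2 -> long RV cat_segment.
Proof.
case=> Phi [Phiex Phimono].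
exists (fun v t => exists2 u, Phi v u & t = existT _ true u); split.
  move=> v; have [t Xt vt] := Phiex v.
  by exists (existT (fun v => seg_type (F v)) true t) => //; exists t.
move=> u v _ _ uv [t ut ->] [t' vt' ->].
by rewrite (lex_beforeE _ implb_wo); exact: (Phimono _ _ _ _ uv ut vt').
Qed.

End Concatenation.

Lemma leads_trans P c c' c'' :
  leads P c c' -> leads P c' c'' -> leads P c c''.
Proof.
move=> [s1 wo1 seg1] [s2 wo2 seg2]; exists (cat_segment s1 s2).
  exact: cat_segment_wo.
exact: cat_segmentP seg2.
Qed.

Lemma leads_diverges halted c c' :
  leads (fun d => ~ halted d) c c' -> diverges halted c' -> diverges halted c.
Proof.
move=> [s1 wo1 seg1] div V RV Vwo Vn.
have [s2 [c'' [wo2 seg2 nh lng]]] := div V RV Vwo Vn.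
exists (cat_segment s1 s2), c''; split=> //.
- exact: cat_segment_wo.
- exact: cat_segmentP seg2.
- exact: cat_segment_long.
Qed.

Lemma leads_halts halted c c' c'' :
  leads (fun d => ~ halted d) c c' -> halts halted c' c'' -> halts halted c c''.
Proof. by move=> cc' [c'c'' h]; split=> //; apply: leads_trans c'c''. Qed.

(** * Comparison of runs over different orders *)

Section Comparison.

(** Bisimilar points have the same ordinal rank within [X] and [X'], so stages of unrelated orders
    are matched without mentioning ordinals. *)
Definition bisimulation (W W' : Type) (R : rel W) (R' : rel W')
    (X : W -> Prop) (X' : W' -> Prop) (E : W -> W' -> Prop) : Prop :=
  forall u u', E u u' -> [/\ X u, X' u',
    forall v, X v -> before R v u ->
      exists v', [/\ X' v', before R' v' u' & E v v']
  & forall v', X' v' -> before R' v' u' ->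
      exists v, [/\ X v, before R v u & E v v']].

Definition same (W W' : Type) (R : rel W) (R' : rel W')
    (X : W -> Prop) (X' : W' -> Prop) u u' : Prop :=
  exists2 E, bisimulation R R' X X' E & E u u'.

Lemma same_bisim (W W' : Type) (R : rel W) (R' : rel W')
    (X : W -> Prop) (X' : W' -> Prop) u u' : same R R' X X' u u' ->
  [/\ X u, X' u',
    forall v, X v -> before R v u ->
      exists v', [/\ X' v', before R' v' u' & same R R' X X' v v']
  & forall v', X' v' -> before R' v' u' ->
      exists v, [/\ X v, before R v u & same R R' X X' v v']].
Proof.
move=> [E Ebis /Ebis[Xu Xu' l r]]; split=> // v Xv vu.
  by have [v' [? ? ?]] := l v Xv vu; exists v'; split=> //; exists E.
by have [v' [? ? ?]] := r v Xv vu; exists v'; split=> //; exists E.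
Qed.

Lemma same_sym (W W' : Type) (R : rel W) (R' : rel W')
    (X : W -> Prop) (X' : W' -> Prop) u u' :
  same R R' X X' u u' -> same R' R X' X u' u.
Proof.
move=> [E Ebis uu']; exists (fun v' v => E v v') => // v' v /Ebis[Xv Xv' l r].
by split.
Qed.

Lemma same_intro (W W' : Type) (R : rel W) (R' : rel W')
    (X : W -> Prop) (X' : W' -> Prop) u u' :
  X u -> X' u' ->
  (forall v, X v -> before R v u ->
    exists v', [/\ X' v', before R' v' u' & same R R' X X' v v']) ->
  (forall v', X' v' -> before R' v' u' ->
    exists v, [/\ X v, before R v u & same R R' X X' v v']) ->
  same R R' X X' u u'.
Proof.
move=> Xu Xu' l r.
exists (fun v v' => (v = u /\ v' = u') \/ same R R' X X' v v'); last by left.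
move=> v v' [[-> ->]|vv']; last have [Xv Xv' vl vr] := same_bisim vv'.
  split=> // w Xw wu; first by have [w' [? ? ?]] := l w Xw wu; exists w'; split; auto.
  by have [w' [? ? ?]] := r w Xw wu; exists w'; split; auto.
split=> // w Xw wv; first by have [w' [? ? ?]] := vl w Xw wv; exists w'; split; auto.
by have [w' [? ? ?]] := vr w Xw wv; exists w'; split; auto.
Qed.

(** If [u] matched both [a] and a later [a'], some [v] before [u] would match [a] and also some [a1]
    before [a]: a descent in [u]. *)
Lemma same_functional (W W' : Type) (R : rel W) (R' : rel W')
    (X : W -> Prop) (X' : W' -> Prop) :
  well_order R -> well_order R' ->
  forall u a a', same R R' X X' u a -> same R R' X X' u a' -> a = a'.
Proof.
move=> Rwo Rwo'.
have nlt u : forall a a', same R R' X X' u a -> same R R' X X' u a' ->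
    ~ before R' a a'.
  elim/(wo_ind Rwo): u => u IH a a' ua ua' aa'.
  have [_ Xa ul _] := same_bisim ua; have [_ _ _ ur'] := same_bisim ua'.
  have [v [Xv vu va]] := ur' a Xa aa'.
  have [a1 [_ a1a va1]] := ul v Xv vu.
  exact: IH vu _ _ va1 va a1a.
move=> u a a' ua ua'; apply: (wo_anti Rwo').
  by apply: contrapT => /negP; apply: nlt ua.
by apply: contrapT => /negP; apply: nlt ua'.
Qed.

Lemma same_mono (W W' : Type) (R : rel W) (R' : rel W')
    (X : W -> Prop) (X' : W' -> Prop) :
  well_order R -> well_order R' ->
  forall u v u' v', same R R' X X' u u' -> same R R' X X' v v' ->
  before R u v -> before R' u' v'.
Proof.
move=> Rwo Rwo' u v u' v' uu' vv' uv.
have [Xu _ _ _] := same_bisim uu'.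
have [_ _ l _] := same_bisim vv'; have [a [_ av' ua]] := l u Xu uv.
by rewrite (same_functional Rwo Rwo' uu' ua).
Qed.

Lemma same_le (W W' : Type) (R : rel W) (R' : rel W')
    (X : W -> Prop) (X' : W' -> Prop) :
  well_order R -> well_order R' ->
  forall u v u' v', same R R' X X' u u' -> same R R' X X' v v' ->
  R u v = R' u' v'.
Proof.
move=> Rwo Rwo' u v u' v' uu' vv'; apply: negb_inj; apply/idP/idP.
  exact: same_mono vv' uu'.
exact: same_mono (same_sym vv') (same_sym uu').
Qed.

Section TwoRuns.
Variables (W W' : Type) (R : rel W) (R' : rel W').
Variables (b : W -> conf S) (b' : W' -> conf S).
Variables (X : W -> Prop) (X' : W' -> Prop) (c0 : conf S).
Hypothesis (Rwo : well_order R) (Rwo' : well_order R').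
Hypothesis (Xrun : run R b c0 X) (Xrun' : run R' b' c0 X').

Local Notation "u ~~~ u'" := (same R R' X X' u u') (at level 70).

Lemma follows_same (D : W -> Prop) (D' : W' -> Prop) c c' :
  (forall u, D u -> exists2 u', D' u' & u ~~~ u') ->
  (forall u', D' u' -> exists2 u, D u & u ~~~ u') ->
  (forall u u', D u -> u ~~~ u' -> b u = b' u') ->
  follows R b c0 D c -> follows R' b' c0 D' c' -> c = c'.
Proof.
move=> DD' D'D bb' Dc D'c'; case: Dc => [D0|m Dm mle|[Dn Dl]].
- by rewrite (follows_first _ D'c') // => u' /D'D[u /D0].
- have [m' Dm' mm'] := DD' m Dm; rewrite (bb' m m' Dm mm').
  apply/esym/(follows_max Rwo' Dm' _ D'c') => u' /D'D[u Du uu'].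
  by rewrite -(same_le Rwo Rwo' uu' mm') mle.
have D'l : limit_set R' D'.
  split; first by have [u /DD'[u' Du' _]] := Dn; exists u'.
  move=> u' /D'D[u /Dl[v Dv uv] uu']; have [v' Dv' vv'] := DD' v Dv.
  by exists v' => //; apply: (same_mono Rwo Rwo' uu' vv').
rewrite (follows_at_limit D'l D'c'); congr lim; apply/funext => j.
apply: asbool_equiv_eq; split=> H.
  move=> u' /D'D[u /H[v [Dv uv bv] uu']]; have [v' Dv' vv'] := DD' v Dv.
  by exists v'; rewrite -(same_le Rwo Rwo' uu' vv') -(bb' v v').
move=> u Du; have [u' Du' uu'] := DD' u Du.
have [v' [/D'D[v Dv vv'] uv bv]] := H u' Du'.
by exists v; rewrite (same_le Rwo Rwo' uu' vv') (bb' v v').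
Qed.

Lemma same_conf u u' : u ~~~ u' -> b u = b' u'.
Proof.
elim/(wo_ind Rwo): u u' => u IH u' uu'; have [Xu Xu' l r] := same_bisim uu'.
apply: follows_same (Xrun Xu) (Xrun' Xu').
- by move=> v [Xv vu]; have [v' [? ? ?]] := l v Xv vu; exists v'.
- by move=> v' [Xv' vu']; have [v [? ? ?]] := r v' Xv' vu'; exists v.
- by move=> v v' [_ vu]; apply: IH.
Qed.

(** One stage set is isomorphic to an initial part of the other, with equal configurations. What
    follows the shorter run is then the configuration at the first unmatched stage of the longer
    one. The third case also keeps the matching, for comparing lengths. *)
Lemma compare c c' : follows R b c0 X c -> follows R' b' c0 X' c' ->
  [\/ c = c',
      exists2 u', X' u' & c = b' u'
    | exists u, [/\ X u, c' = b u &
        forall u', X' u' -> exists2 v, before R v u & v ~~~ u']].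
Proof.
move=> Xc Xc'.
have [all|/existsNP[u0 /not_implyP[Xu0 nu0]]] :=
    pselect (forall u, X u -> exists u', u ~~~ u'); last first.
  have [|u [Xu nu] ule] :=
      wo_min Rwo (P := fun u => X u /\ ~ exists u', u ~~~ u'); first by exists u0.
  have low v : X v -> before R v u -> exists v', v ~~~ v'.
    move=> Xv vu; apply: contrapT => nv.
    by move: vu; rewrite /before ule.
  (* The least [u'] not matched below [u] would have the same rank as [u] and hence match it. *)
  have all' u' : X' u' -> exists2 v, before R v u & v ~~~ u'.
    elim/(wo_ind Rwo'): u' => u' IH Xu'; apply: contrapT => nv.
    apply: nu; exists u'; apply: same_intro => //.
      move=> v Xv vu; have [v' vv'] := low v Xv vu.
      have [_ Xv' _ rv'] := same_bisim vv'; exists v'; split=> //.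
      apply/negP => /(le_eq_before Rwo')[e|u'v'].
        by apply: nv; exists v; rewrite // e.
      by apply: nv; have [w [_ wv wu']] := rv' u' Xu' u'v'; exists w => //;
        apply: (before_trans Rwo wv).
    move=> v' Xv' v'u'; have [v vu vv'] := IH v' v'u' Xv'.
    by exists v; split=> //; have [] := same_bisim vv'.
  apply: Or33; exists u; split=> //.
  apply/esym; apply: follows_same (Xrun Xu) Xc'.
  - move=> v [Xv vu]; have [v' vv'] := low v Xv vu.
    by exists v' => //; have [] := same_bisim vv'.
  - move=> u' /all'[v vu vu']; exists v => //.
    by have [] := same_bisim vu'.
  - by move=> v v' _; apply: same_conf.
have [all'|/existsNP[u0 /not_implyP[Xu0 nu0]]] :=
    pselect (forall u', X' u' -> exists u, u ~~~ u').
  apply: Or31; apply: follows_same Xc Xc'.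
  - by move=> u /all[u' uu']; exists u' => //; have [] := same_bisim uu'.
  - by move=> u' /all'[u uu']; exists u => //; have [] := same_bisim uu'.
  - by move=> u u' _; apply: same_conf.
have [|u' [Xu' nu'] ule] :=
    wo_min Rwo' (P := fun u' => X' u' /\ ~ exists u, u ~~~ u'); first by exists u0.
apply: Or32; exists u' => //; apply: follows_same Xc (Xrun' Xu').
- move=> u /all[v' uv']; exists v' => //; have [Xu Xv' l r] := same_bisim uv'.
  split=> //; apply/negP => /(le_eq_before Rwo')[e|u'v'].
    by apply: nu'; exists u; rewrite e.
  by apply: nu'; have [w [_ _ ww]] := r u' Xu' u'v'; exists w.
- move=> v' [Xv' v'u']; apply: contrapT => nv'.
  have : R' u' v'.
    apply: ule; split=> // -[v vv']; apply: nv'; exists v => //.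
    by have [] := same_bisim vv'.
  by move: v'u'; rewrite /before => /negP.
- by move=> u v' _; apply: same_conf.
Qed.

End TwoRuns.

(* A strictly increasing map of a well-order into itself is at least the
   identity. *)
Lemma long_unmatched (W W' : Type) (R : rel W) (R' : rel W')
    (X : W -> Prop) (X' : W' -> Prop) (Phi : W -> W' -> Prop) :
  well_order R -> well_order R' ->
  (forall v, exists2 t, X' t & Phi v t) ->
  (forall u v t t', before R u v -> Phi u t -> Phi v t' -> before R' t t') ->
  forall v u t, same R R' X X' u t -> Phi v t -> R v u.
Proof.
move=> Rwo Rwo' ex mono; elim/(wo_ind Rwo) => v IH u t ut vt.
apply: contrapT => /negP uv; have [t0 Xt0 ut0] := ex u.
have [_ _ _ r] := same_bisim ut.
have [w [_ wu wt0]] := r t0 Xt0 (mono _ _ _ _ uv ut0 vt).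
by move: wu; rewrite /before (IH u uv w t0).
Qed.

End Comparison.

(** If one run were longer, it would visit the halted configuration that ends the shorter one. *)
Lemma halts_unique halted c c1 c2 :
  halts halted c c1 -> halts halted c c2 -> c1 = c2.
Proof.
move=> [[s1 wo1 [_ run1 P1 next1]] h1] [[s2 wo2 [_ run2 P2 next2]] h2].
have [//|[u Xu e]|[u [Xu e _]]] := compare wo1 wo2 run1 run2 next1 next2.
  by case: (P2 u Xu); rewrite -e.
by case: (P1 u Xu); rewrite -e.
Qed.

(** Divergence is applied to the order of the halting segment itself: a segment that long cannot be
    matched below a stage of it. *)
Lemma diverges_not_halts halted c c' : diverges halted c -> ~ halts halted c c'.
Proof.
move=> div [[s1 wo1 [s1n run1 P1 next1]] h1].
have s1t : exists v : seg_type s1, True by case: s1n => u; exists u.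
have [s2 [c2 [wo2 [_ run2 P2 next2] nh [Phi [Phiex Phimono]]]]] :=
  div _ _ wo1 s1t.
have [e|[u Xu e]|[u [Xu e all]]] := compare wo1 wo2 run1 run2 next1 next2.
- by apply: nh; rewrite -e.
- by case: (P2 u Xu); rewrite -e.
have [t Xt ut] := Phiex u; have [v vu vt] := all t Xt.
move: vu; rewrite /before.
by rewrite (long_unmatched wo1 wo2 Phiex Phimono vt ut).
Qed.

End Runs.

(** * Simulation of one system by another *)

Section Simulation.
Variables (S1 S2 : system).
Variables (halted1 : conf S1 -> Prop) (halted2 : conf S2 -> Prop).
(* [enc] is not the graph of [e]: a simulated machine may also enter its limit
   state at a successor stage, and then the simulating machine does not. *)
Variables (enc : conf S1 -> conf S2 -> Prop) (e : conf S1 -> conf S2).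
(* Each cell of S2 either is constant or simulates a cell of S1. *)
Variable cell : idx S2 -> bool + idx S1.
Variable P : conf S2 -> Prop.

Definition copy_bits (f : idx S1 -> bool) (j : idx S2) : bool :=
  match cell j with inl a => a | inr i => f i end.

Hypothesis enc_e : forall c, enc c (e c).
Hypothesis enc_lim : forall f, enc (lim f) (lim (copy_bits f)).
Hypothesis enc_bit : forall c d j, enc c d -> bit d j = copy_bits (bit c) j.
Hypothesis enc_next : forall c d, enc c d -> ~ halted1 c ->
  leads (fun d' => P d' /\
           forall j, bit d' j = bit d j \/
                     bit d' j = copy_bits (bit (next_conf c)) j)
    d (e (next_conf c)).

Section Run.
Variables (V : Type) (RV : rel V) (b : V -> conf S1) (X : V -> Prop).
Variables (c c' : conf S1).
Hypothesis Vwo : well_order RV.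
Hypothesis Xn : exists v, X v.
Hypothesis Xrun : run RV b c X.
Hypothesis Xnext : follows RV b c X c'.
Hypothesis Xh : forall v, X v -> ~ halted1 (b v).

(** After a limit set the simulating system is in its own limit configuration, otherwise in the
    canonical one; this depends on [D] and not on [c] alone. *)
Let E (D : V -> Prop) (c : conf S1) : conf S2 :=
  if pselect (limit_set RV D) then lim (copy_bits (limsup_bit RV b D)) else e c.

Let follows_enc c0 D d : follows RV b c0 D d -> enc d (E D d).
Proof.
rewrite /E; case: pselect => [Dl dP|nDl _] /=; last exact: enc_e.
by rewrite (follows_at_limit Dl dP); apply: enc_lim.
Qed.

Let below v u := X u /\ before RV u v.

Lemma simulate_run : exists s d,
  [/\ well_order (@seg_rel _ s), enc c' d,
      is_segment (fun d' => P d' /\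
        forall j, if cell j is inl a then bit d' j = a else True) (e c) d s
    & exists Phi : V -> seg_type s -> Prop,
      (forall v, X v -> exists2 t, seg_stages t & Phi v t) /\
      forall u v t t', before RV u v -> Phi u t -> Phi v t' ->
        before (@seg_rel _ s) t t'].
Proof.
pose En v := E (below v) (b v).
have encE v : X v -> enc (b v) (En v) by move=> /Xrun; apply: follows_enc.
have [F [Fwo FP]] := segment_family (fun v Xv => enc_next (encE v Xv) (Xh Xv)).
pose W v := seg_type (F v); pose R v := @seg_rel _ (F v).
pose bF v := @seg_conf _ (F v); pose XF v := @seg_stages _ (F v).
have Fn v : X v -> exists u : W v, XF v u by case/FP.
have Frun v : X v -> run (R v) (bF v) (En v) (XF v) by case/FP.
have lwo := lex_wo Vwo Fwo.
pose ST := sum_stages X XF; pose B := sum_run bF.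
(* For an initial part [D] of [X], what follows [D] in the simulated run is simulated by what
   follows all segments over [D]. *)
have low D d : (forall v, D v -> X v) ->
    (forall v u, D v -> X u -> before RV u v -> D u) ->
    follows RV b c D d ->
    follows (lex RV R) B (e c) (fun s => ST s /\ D (projT1 s)) (E D d).
  move=> DX Ddown Dd; rewrite /E; case: pselect => [Dl|nDl] /=.
    have -> : copy_bits (limsup_bit RV b D) =
        limsup_bit (lex RV R) B (fun s => ST s /\ D (projT1 s)).
      apply/funext => j; rewrite /copy_bits /limsup_bit.
      have bitB v (u : W v) : X v -> XF v u -> bit (bF v u) j = bit (En v) j \/
          bit (bF v u) j = copy_bits (bit (next_conf (b v))) j.
        by move=> /FP[_ _ + _] Xu => /(_ u Xu)[].
      have bitE v : X v -> bit (En v) j = copy_bits (bit (b v)) j.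
        by move=> /encE/enc_bit.
      case cj : (cell j) => [a|i].
        have bita v (u : W v) : X v -> XF v u -> bit (bF v u) j = a.
          move=> Xv /(bitB v u Xv)[]->; rewrite ?bitE // /copy_bits cj //.
        apply/idP/asboolP => [Ha [v u] [[Xv Xu] Dv]|].
          exists (existT W v u); split=> //; first exact: wo_refl.
          by rewrite /B /sum_run /= bita.
        have [v Dv] := Dl.1; have [u Xu] := Fn v (DX v Dv).
        case/(_ (existT W v u) (conj (conj (DX v Dv) Xu) Dv)).
        move=> [v' u'] [[[/= Xv' Xu'] Dv'] _].
        by rewrite /B /sum_run /= bita.
      apply: asbool_equiv_eq; split=> H.
        (* A strictly later index [w] is needed: the first stage of the segment over [v] may precede
           [u]. *)
        case=> v u [[/= Xv Xu] Dv]; have [w Dw vw] := Dl.2 v Dv.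
        have [x [Dx wx bx]] := H w Dw; have Xx := DX x Dx.
        have [y [Xy yE _]] := run_first (Fwo x) (Frun x Xx) (Fn x Xx).
        exists (existT W x y); split=> //.
          apply: (before_le lwo); apply: (lex_before _ Vwo).
          exact: before_le_trans wx.
        have yE' : bF x y = En x by [].
        by rewrite /B /sum_run /= yE' bitE // /copy_bits cj.
      move=> v Dv; have [u Xu] := Fn v (DX v Dv).
      have [[w x] [[[/= Xw Xx] Dw] uw]] := H (existT W v u) (conj (conj (DX v Dv) Xu) Dv).
      have vw := lex_le_tag Vwo uw.
      rewrite /B /sum_run /=; case: (bitB w x Xw Xx) => ->.
        by rewrite bitE // /copy_bits cj; exists w.
      (* The value after the step at [w] is the value at the successor stage of [w], which is in [D]
         because [D] has no last stage. *)
      rewrite /copy_bits cj; have [y Dy wy] := Dl.2 w Dw.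
      have [|z [Xz wz ze zle]] := run_succ Vwo Xrun Xw.
        by exists y => //; apply: DX.
      exists z; rewrite ze; split=> //.
        have [ezy|zy] := le_eq_before Vwo (zle y (DX y Dy) wy); first by rewrite ezy.
        exact: Ddown zy.
      exact: (wo_trans Vwo vw (before_le Vwo wz)).
    apply: follows_limit; split.
      have [v Dv] := Dl.1; have [u Xu] := Fn v (DX v Dv).
      by exists (existT W v u); split=> //; split=> //; apply: DX.
    case=> v u [[/= Xv Xu] Dv]; have [w Dw vw] := Dl.2 v Dv.
    have Xw := DX w Dw; have [x Xx] := Fn w Xw.
    by exists (existT W w x) => //; apply: (lex_before _ Vwo).
  case: Dd nDl => [D0 _|m Dm mle _|//].
    by apply: follows_zero => -[v u] [_ /= /D0].
  have Xm := DX m Dm.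
  apply: (@follows_sum _ _ _ _ _ Vwo Fwo _ En _ m _ (XF m)) (Fn m Xm) _ _ _.
  - by move=> u Xu; split.
  - case=> v u [[/= Xv Xu] /mle /(le_eq_before Vwo)[evm|]]; last by left.
    by subst v; right; exists u.
  - by have [] := FP m Xm.
exists (SegmentData (lex RV R) B ST), (E X c'); split=> //.
- exact: follows_enc Xnext.
- split=> //=.
  + by have [v Xv] := Xn; have [u Xu] := Fn v Xv; exists (existT W v u).
  + apply: (run_sum Vwo Fwo Frun) => v Xv.
    apply: eq_follows (low (below v) (b v) _ _ (Xrun Xv)) => [s|w []//|w u []].
      split=> -[Xs]; first by case.
      by move=> sv; split=> //; split=> //; case: Xs.
    by move=> Xw wv Xu uw; split=> //; apply: (before_trans Vwo uw).
  + case=> v u [/= Xv Xu]; have [_ _ + _] := FP v Xv => /(_ u Xu)[Pd bd].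
    split=> // j; move: (bd j); rewrite (enc_bit j (encE v Xv)) /copy_bits.
    by case: cell => [a [|]|].
  + apply: eq_follows (low X c' _ _ Xnext) => // s.
    by split=> [[]//|Xs]; split=> //; case: Xs.
- exists (fun v (t : {v & W v}) => projT1 t = v); split=> [v Xv|].
    by have [u Xu] := Fn v Xv; exists (existT W v u).
  by move=> u v [? t] [? t'] uv /= ut vt'; subst; apply: (lex_before _ Vwo).
Qed.

End Run.

Lemma simulate_halts c c' : leads (fun d => ~ halted1 d) c c' ->
  exists2 d, enc c' d & leads (fun d' => P d' /\
    forall j, if cell j is inl a then bit d' j = a else True) (e c) d.
Proof.
move=> [s swo [sn srun sh snext]].
by have [s' [d [wo' encd seg' _]]] := simulate_run swo sn srun snext sh;
  exists d => //; exists s'.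
Qed.

(** The run along an arbitrary [RV] never halts, and its simulation spends at least one stage on
    each point of [RV], so it is long enough. *)
Lemma simulate_diverges c : (forall d, P d -> ~ halted2 d) ->
  ~ halted1 c -> ~ (exists c', halts halted1 c c') -> diverges halted2 (e c).
Proof.
move=> Ph hc nhc V RV Vwo Vn; have [b brun] := run_exists c Vwo.
have noth v : ~ halted1 (b v).
  apply: contrapT => /contrapT hv.
  have [|w hw wle] := wo_min Vwo (P := fun v => halted1 (b v)); first by exists v.
  have [w0|/existsNP[u /contrapT uw]] := pselect (forall u, ~ before RV u w).
    apply: hc; rewrite -(follows_first _ (brun w I)) //.
    by move=> u [_]; apply: w0.
  apply: nhc; exists (b w); split=> //.
  exists (SegmentData RV b (fun u => before RV u w)) => //; split=> /=.
  - by exists u.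
  - move=> x xw; apply: eq_follows (brun x I) => y; split=> -[_] yx //.
    by split=> //; apply: (before_trans Vwo yx).
  - by move=> x xw /wle; apply/negP.
  - by apply: eq_follows (brun w I) => x; split=> // -[].
have [c' bc'] := follows_exists RV b c (fun=> True).
have hc' : ~ halted1 c'.
  move=> h; apply: nhc; exists c'; split=> //.
  exists (SegmentData RV b (fun=> True)) => //; split=> //=.
have VX : exists v : V, (fun=> True) v by case: Vn => v; exists v.
have [s [d [swo encd [sn srun sP snext] [Phi [Phiex Phimono]]]]] :=
  simulate_run Vwo VX brun bc' (fun v _ => noth v).
exists s, d; split=> //.
- by split=> // u /sP[/Ph].
- by have [/Ph] := leads_start (enc_next encd hc').
- by exists Phi; split=> // v; apply: Phiex.
Qed.

End Simulation.

(** * Programs as transfinite systems *)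

Inductive tape := Input | Scratch | Output.

Section ProgramSystem.
Variable p : program.

Definition program_system : system := {|
  conf := config (states p);
  idx := nat * tape;
  next_conf := @step p;
  bit := fun c j => match j.2 with
    | Input => input_tape c j.1
    | Scratch => scratch_tape c j.1
    | Output => output_tape c j.1
    end;
  lim := fun f => Config (limit_state p) 0 (fun n => f (n, Input))
    (fun n => f (n, Scratch)) (fun n => f (n, Output))
|}.

Definition program_halted (c : conf program_system) : Prop :=
  state c = halt_state p.

Lemma start_neq_halt : start_state p <> halt_state p.
Proof. by have /and3P[] := states_uniq p; rewrite !inE => /norP[/eqP]. Qed.

Lemma limit_neq_halt : limit_state p <> halt_state p.
Proof.
have /and3P[_] := states_uniq p; rewrite !inE => /eqP + _.
by apply: contra_not.
Qed.

Lemma limsup_tapeE (W : Type) (R : rel W) (b : W -> config (states p)) w t :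
  limsup_tape R (fun v => match t with Input => input_tape (b v)
     | Scratch => scratch_tape (b v) | Output => output_tape (b v) end) w =
  fun n => limsup_bit (S := program_system) R b (fun u => before R u w) (n, t).
Proof.
by apply/funext => n; case: t; apply: asbool_equiv_eq; split=> H u /H[v []];
  exists v.
Qed.

Lemma limit_configE (W : Type) (R : rel W) (b : W -> config (states p)) w :
  limit_config R b w =
  lim (limsup_bit (S := program_system) R b (fun u => before R u w)).
Proof.
rewrite /limit_config /=; congr Config.
- exact: (limsup_tapeE R b w Input).
- exact: (limsup_tapeE R b w Scratch).
- exact: (limsup_tapeE R b w Output).
Qed.

Section Stages.
Variables (W : Type) (R : rel W) (b : W -> config (states p)) (x : real).
Hypothesis Rwo : well_order R.

Lemma is_runP : is_run R x b <->
  forall w, follows (S := program_system) R b (start_config p x)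
    (fun u => before R u w) (b w).
Proof.
split=> [[b0 bS bl] w|H].
  have [w0|/existsNP[u0 /contrapT u0w]] := pselect (forall u, ~ before R u w).
    rewrite b0; first exact: follows_zero.
    by move=> u; apply: contrapT => /negP; apply: w0.
  have [[m mw mle]|nomax] := pselect (exists2 m, before R m w &
      forall u, before R u w -> R u m).
    by rewrite (bS m) //; apply: (@follows_succ program_system).
  have wl : limit_stage R w.
    split=> [|v vw]; first by exists u0.
    apply: contrapT => nv; apply: nomax; exists v => // u uw.
    by apply: contrapT => /negP vu; apply: nv; exists u.
  rewrite bl // limit_configE; apply: follows_limit; split; first by case: wl.
  by move=> v vw; have [u vu uw] := wl.2 v vw; exists u.
split=> [w w0|v w [vw vle]|w [wn wl]].
- by apply: (follows_first _ (H w)) => u; rewrite /before w0.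
- exact: (follows_max Rwo vw vle (H w)).
- rewrite limit_configE; apply: (follows_at_limit _ (H w)); split=> // u uw.
  by have [v uv vw] := wl u uw; exists v.
Qed.

End Stages.

Section AddTop.
Variables (W : Type) (R : rel W) (b : W -> config (states p)) (X : W -> Prop).
Variable c' : config (states p).
Hypothesis Rwo : well_order R.

(** In [outputs] every point of the order is a stage and the halting configuration sits at one of
    them, whereas a segment lives on a subset and ends just before it. Hence the restriction to [X]
    and the added top. *)
Let T := option {u | X u}.

Definition top_rel (s t : T) : bool :=
  match s, t with
  | _, None => true
  | None, Some _ => false
  | Some u, Some v => R (sval u) (sval v)
  end.

Definition top_conf (s : T) : config (states p) :=
  if s is Some u then b (sval u) else c'.

Lemma top_wo : well_order top_rel.
Proof.
apply: antisymmetric_well_order => [[[u Xu]|] [[v Xv]|] //= /andP[uv vu]|A An].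
  have e := wo_anti Rwo uv vu; subst v.
  by rewrite (Prop_irrelevance Xu Xv).
have [[u Au]|nA] := pselect (exists u, Some u \in A).
  have [|m [Xm Am] mle] :=
      wo_min Rwo (P := fun w => exists Xw : X w, Some (exist _ w Xw) \in A).
    by case: u Au => u Xu Au; exists u, Xu.
  exists (Some (exist _ m Xm)); split=> // -[[w Xw]|//] Aw.
  by apply: mle; exists Xw.
case: An => -[u Au|An]; first by case: nA; exists u.
by exists None; split=> // -[u Au|//]; case: nA; exists u.
Qed.

Lemma follows_top c0 (D : W -> Prop) (D' : T -> Prop) c :
  (forall u, D u -> X u) -> (forall u, D' (Some u) <-> D (sval u)) ->
  ~ D' None ->
  follows (S := program_system) R b c0 D c ->
  follows (S := program_system) top_rel top_conf c0 D' c.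
Proof.
move=> DX D'D nD'; case=> [D0|m Dm mle|[[v Dv] Dl]].
- by apply: follows_zero => -[u|//] /D'D /D0.
- apply: (@follows_succ program_system _ _ top_conf _ _
    (Some (exist _ m (DX m Dm)))).
    exact/D'D.
  by move=> [u|//] /D'D /mle.
have -> : limsup_bit (S := program_system) R b D =
    limsup_bit (S := program_system) top_rel top_conf D'.
  apply/funext => j; apply: asbool_equiv_eq; split=> H.
    move=> [u|//] /D'D/H[w [Dw uw bw]]; exists (Some (exist _ w (DX w Dw))).
    by split=> //; apply/D'D.
  move=> u Du; have D'u : D' (Some (exist _ u (DX u Du))) by apply/D'D.
  have [[w|] [D'w uw bw]] := H _ D'u; last by case: nD'.
  by exists (sval w); split=> //; apply/D'D.
apply: follows_limit; split; first by exists (Some (exist _ v (DX v Dv))); apply/D'D.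
move=> [u|//] /D'D/Dl[w Dw uw]; exists (Some (exist _ w (DX w Dw))) => //.
exact/D'D.
Qed.

End AddTop.

Lemma outputsP x y : outputs p x y <->
  exists2 c', halts program_halted (start_config p x) c' & output_tape c' = y.
Proof.
split=> [[W [R [b [w [Rwo bR [hw nh] bw]]]]]|[c' [[s swo [sn srun sh snext] hc']] <-]].
  have bP := (is_runP b x Rwo).1 bR; exists (b w) => //; split=> //.
  exists (@SegmentData program_system _ R b (fun u => before R u w)) => //.
  split=> //= [|v vw].
    (* A segment needs a stage: the halting stage is not the first one, since the start state is not
       the halt state. *)
    apply: contrapT => w0; apply: start_neq_halt.
    rewrite -hw (follows_first _ (bP w)) // => u uw.
    by apply: w0; exists u.
  apply: eq_follows (bP v) => u; split=> [uv|[]//].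
  by split=> //; apply: before_trans vw.
case: s swo sn srun sh snext => W R b X /= Rwo [u0 Xu0] brun bh bnext.
exists _, (top_rel R (X := X)), (top_conf b c'), None; split=> //.
- exact: top_wo.
- apply/(is_runP _ _ (top_wo Rwo)) => -[[w Xw]|].
    apply: (follows_top _ _ _ _ (brun w Xw)) => [u []//|[u Xu]|//].
    by split=> // -[].
  by apply: (follows_top _ _ _ _ bnext) => // -[u Xu].
- split=> // -[[u Xu] _|//]; exact: bh.
Qed.

End ProgramSystem.

(** * Multitrack machines *)

Record multitrack (I : finType) := Multitrack {
  mstates : finType;
  mstart : mstates;
  mhalt : mstates;
  mlimit : mstates;
  mstart_neq_halt : mstart <> mhalt;
  mlimit_neq_halt : mlimit <> mhalt;
  mdelta : mstates -> {ffun I -> bool} -> mstates * {ffun I -> bool} * bool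
}.

Record mconfig (Q : Type) (I : finType) := MConfig {
  mstate : Q;
  mhead : nat;
  mtape : nat -> {ffun I -> bool}
}.

Definition mmove (d : bool) (h : nat) : nat := if d then h.+1 else h.-1.

Section MultitrackSystem.
Variables (I : finType) (M : multitrack I).
Implicit Types (c : mconfig (mstates M) I).

Definition mstep c : mconfig (mstates M) I :=
  let: (q, s, d) := mdelta (mstate c) (mtape c (mhead c)) in
  MConfig q (mmove d (mhead c)) [eta mtape c with mhead c |-> s].

Definition multitrack_system : system := {|
  conf := mconfig (mstates M) I;
  idx := nat * I;
  next_conf := mstep;
  bit := fun c j => mtape c j.1 j.2;
  lim := fun f => MConfig (mlimit M) 0 (fun n => [ffun i => f (n, i)])
|}.

Definition mhalted (c : conf multitrack_system) : Prop := mstate c = mhalt M.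

(* The track io holds the input at the start and the output at the end. *)
Definition mstart_conf (io : I) (x : real) : conf multitrack_system :=
  MConfig (mstart M) 0 (fun n => [ffun i => (i == io) && x n]).

(** The head has to stop on cell 0, where the gathering of the output starts and records its
    phase. *)
Definition mcomputes (io : I) (F : real -> real -> Prop) : Prop :=
  forall x,
    (exists c', [/\ halts mhalted (mstart_conf io x) c', mhead c' = 0
       & forall y, F x y <-> (fun n => mtape c' n io) = y]) \/
    (~ (exists c', halts mhalted (mstart_conf io x) c') /\ forall y, ~ F x y).

End MultitrackSystem.

Lemma writeE t i b n : write t i b n = if n == i then b else t n.
Proof. by []. Qed.

Lemma write_id t i : write t i (t i) = t.
Proof. by apply/funext => n; rewrite writeE; case: eqP => // ->. Qed.

Lemma leads_cons (S : system) (P : conf S -> Prop) c c' :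
  P c -> leads P (next_conf c) c' -> leads P c c'.
Proof. by move=> /leads_step; apply: leads_trans. Qed.

Lemma leads_last (S : system) (P : conf S -> Prop) c c' :
  P c -> next_conf c = c' -> leads P c c'.
Proof. by move=> /leads_step + <-. Qed.

(** * Three-tape programs for multitrack machines *)

Section Compile.
Variables (I : finType) (M : multitrack I) (io : I).

(** One more than the number of tracks: [io] is listed once more in front to get rank 0, and k > 1
    keeps cells j and k * j apart for j > 0. *)
Local Notation k := #|I|.+1.
Local Notation F := {ffun I -> bool}.
Local Notation Q := (mstates M).

(* Track i of cell n is kept on the output tape, in cell k * n + rank i. *)
Definition rank (i : I) : nat := index i (io :: enum I).

Lemma rank_io : rank io = 0.
Proof. by rewrite /rank /= eqxx. Qed.

Lemma rank_lt i : rank i < k.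
Proof.
rewrite cardE -[X in _ < X.+1]/(size (enum I)) /rank index_mem.
by rewrite inE mem_enum orbT.
Qed.

Lemma rank_inj : injective rank.
Proof.
move=> i j e; have ij i' : i' \in io :: enum I by rewrite inE mem_enum orbT.
by rewrite -(nth_index io (ij i)) -(nth_index io (ij j)) -/(rank _) e.
Qed.

Lemma k_gt1 : 1 < k.
Proof. by rewrite ltnS; apply/card_gt0P; exists io. Qed.

Definition track_at (t : nat) : option I := [pick i | rank i == t].

Lemma track_at_rank i : track_at (rank i) = Some i.
Proof.
by rewrite /track_at; case: pickP => [j /eqP/rank_inj->//|/(_ i)]; rewrite eqxx.
Qed.

Lemma track_atP t i : track_at t = Some i -> rank i = t.
Proof. by rewrite /track_at; case: pickP => // j /eqP jt [<-]. Qed.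

Definition bit_at (s : F) (t : nat) : bool :=
  if track_at t is Some i then s i else false.

(* [Adv], [ToNear], [Mark], [ToFar]: the loop that moves bit j of a real from
   cell j to cell k * j (if the boolean m is true) or from cell k * j to
   cell j (if m is false), where cells j and k * j are marked on the scratch
   tape; the first component of [Adv] and [ToNear] is true before the first
   round.
   [Read], [WriteBack], [Move]: simulation of one step of M. *)
Inductive cstate :=
| CStart | CLim | CHalt
| Adv (first m beta : bool) (t : 'I_k)
| ToNear (first m beta : bool)
| Mark (m : bool)
| ToFar (m beta : bool)
| Read (q : Q) (a : F) (t : 'I_k)
| WriteBack (q : Q) (a : F) (d : bool) (t : 'I_k)
| Move (q : Q) (d : bool) (t : 'I_k).

Definition cstate_code (s : cstate) :
    'I_3 + bool * bool * bool * 'I_k + bool * bool * bool + bool +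
    bool * bool + Q * F * 'I_k + Q * F * bool * 'I_k + Q * bool * 'I_k :=
  match s with
  | CStart => inl (inl (inl (inl (inl (inl (inl (@inord 2 0)))))))
  | CLim => inl (inl (inl (inl (inl (inl (inl (@inord 2 1)))))))
  | CHalt => inl (inl (inl (inl (inl (inl (inl (@inord 2 2)))))))
  | Adv f m b t => inl (inl (inl (inl (inl (inl (inr (f, m, b, t)))))))
  | ToNear f m b => inl (inl (inl (inl (inl (inr (f, m, b))))))
  | Mark m => inl (inl (inl (inl (inr m))))
  | ToFar m b => inl (inl (inl (inr (m, b))))
  | Read q a t => inl (inl (inr (q, a, t)))
  | WriteBack q a d t => inl (inr (q, a, d, t))
  | Move q d t => inr (q, d, t)
  end.

Definition cstate_decode
    (s : 'I_3 + bool * bool * bool * 'I_k + bool * bool * bool + bool +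
    bool * bool + Q * F * 'I_k + Q * F * bool * 'I_k + Q * bool * 'I_k) : cstate :=
  match s with
  | inl (inl (inl (inl (inl (inl (inl i)))))) =>
      if i == 0 :> nat then CStart else if i == 1 :> nat then CLim else CHalt
  | inl (inl (inl (inl (inl (inl (inr (f, m, b, t))))))) => Adv f m b t
  | inl (inl (inl (inl (inl (inr (f, m, b)))))) => ToNear f m b
  | inl (inl (inl (inl (inr m)))) => Mark m
  | inl (inl (inl (inr (m, b)))) => ToFar m b
  | inl (inl (inr (q, a, t))) => Read q a t
  | inl (inr (q, a, d, t)) => WriteBack q a d t
  | inr (q, d, t) => Move q d t
  end.

Lemma cstate_codeK : cancel cstate_code cstate_decode.
Proof. by case=> //=; rewrite inordK. Qed.

HB.instance Definition _ := Finite.copy cstate (can_type cstate_codeK).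

Definition dir (d : bool) : direction := if d then MoveRight else MoveLeft.

(** The write at offset 0 already makes one move in direction [d], so k - 1 moves, the value of
    [ord_max], remain to the neighbouring block. *)
Definition write_delta q a d (t : 'I_k) (s : symbol) :
    cstate * symbol * direction :=
  let: (i, m, o) := s in
  if t == 0 :> nat then (Move q d ord_max, (i, m, bit_at a t), dir d)
  else (WriteBack q a d (inord t.-1), (i, m, bit_at a t), MoveLeft).

Definition read_delta q (a : F) (t : 'I_k) (s : symbol) :
    cstate * symbol * direction :=
  let: (i, m, o) := s in
  if q == mhalt M then
    (Adv true false false ord_max, (true, true, o), MoveRight)
  else
    let a' := [ffun j => if rank j == t then o else a j] in
    if t == ord_max then
      let: (q', a'', d) := mdelta q a' in write_delta q' a'' d t s
    else (Read q a' (inord t.+1), s, MoveRight).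

(* At a limit, cell 0 tells the phase: the scratch tape holds 0 during the
   simulation and 1 otherwise, and then the input tape holds 0 while the input
   is being spread out and 1 while the output is being gathered. *)
Definition cdelta (st : cstate) (s : symbol) : cstate * symbol * direction :=
  let: (i, m, o) := s in
  match st with
  | CStart => (Adv true true false ord_max, (false, true, i), MoveRight)
  | CLim =>
      if m then
        if i then (CHalt, s, MoveLeft)
        else (Read (mstart M) [ffun=> false] ord0, (i, false, o), MoveLeft)
      else read_delta (mlimit M) [ffun=> false] ord0 s
  | CHalt => (CHalt, s, MoveLeft)
  | Adv f w b t =>
      if t == 0 :> nat then (ToNear f w b, (i, true, o), MoveLeft)
      else (Adv f w b (inord t.-1), s, MoveRight)
  | ToNear f w b =>
      if m then
        (Mark w, if f then s else (i, false, if w then o else b), MoveRight)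
      else (ToNear f w b, s, MoveLeft)
  | Mark w => (ToFar w i, (i, true, o), MoveRight)
  | ToFar w b =>
      if m then
        let b' := if w then b else o in
        (Adv false w b' ord_max, (i, false, b'), MoveRight)
      else (ToFar w b, s, MoveRight)
  | Read q a t => read_delta q a t s
  | WriteBack q a d t => write_delta q a d t s
  | Move q d t =>
      ((if t <= 1 then Read q [ffun=> false] ord0 else Move q d (inord t.-1)),
       s, dir d)
  end.

Lemma cstates_uniq : uniq [:: CStart; CHalt; CLim].
Proof. by rewrite /= !inE; apply/and3P; split=> //; [apply/norP; split|]; apply/eqP. Qed.

Definition compiled : program :=
  {| states := cstate; start_state := CStart; halt_state := CHalt;
     limit_state := CLim; states_uniq := cstates_uniq; delta := cdelta |}.

Local Notation C := (@Config cstate).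
Local Notation SC := (program_system compiled).

Lemma next_confE q h i s o q' a1 a2 a3 d :
  cdelta q (i h, s h, o h) = (q', (a1, a2, a3), d) ->
  next_conf (C q h i s o : conf SC) =
    C q' (move_head d h) (write i h a1) (write s h a2) (write o h a3).
Proof.
move=> e; transitivity (let: (q1, (b1, b2, b3), d1) := cdelta q (i h, s h, o h) in
  C q1 (move_head d1 h) (write i h b1) (write s h b2) (write o h b3)) => //.
by rewrite e.
Qed.

Section SimulatedStep.
Variables (i0 : real) (c : conf (multitrack_system M)).
Hypothesis hc : ~ mhalted c.

Definition spread_tape (tp : nat -> F) : real :=
  fun n => bit_at (tp (n %/ k)) (n %% k).

Definition simulating (tp : nat -> F) : conf SC -> Prop := fun d =>
  [/\ state d <> CHalt, input_tape d = i0, scratch_tape d = real0 &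
      forall n, output_tape d n = spread_tape (mtape c) n \/
                output_tape d n = spread_tape tp n].

Definition spread_conf (c : conf (multitrack_system M)) : conf SC :=
  C (Read (mstate c) [ffun=> false] ord0) (k * mhead c) i0 real0
    (spread_tape (mtape c)).

Variables (q' : Q) (s' : F) (d : bool).
Hypothesis step_c : mdelta (mstate c) (mtape c (mhead c)) = (q', s', d).

Let h := mhead c.
Let tp' : nat -> F := [eta mtape c with h |-> s'].
Let o0 := spread_tape (mtape c).
Let o1 := spread_tape tp'.
Let target := C (Read q' [ffun=> false] ord0) (k * mmove d h) i0 real0 o1.

Let sym (o : real) p : symbol := (i0 p, real0 p, o p).

Let write_real0 n : write real0 n false = real0.
Proof. by apply/funext => m; rewrite writeE if_same. Qed.

(** [Move] with counter [t] makes [t] moves. Truncated subtraction covers the left end: from block 0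
    a move to the left stays on cell 0. *)
Let move_phase t p : 0 < t < k ->
  (if d then p + t = k * h.+1 else p - t = k * h.-1) ->
  leads (simulating tp') (C (Move q' d (inord t)) p i0 real0 o1) target.
Proof.
elim: t p => // t IH p /andP[_ tk] pt.
have sim : simulating tp' (C (Move q' d (inord t.+1)) p i0 real0 o1).
  by split=> // n; right.
have e : next_conf (C (Move q' d (inord t.+1)) p i0 real0 o1 : conf SC) =
    C (if t.+1 <= 1 then Read q' [ffun=> false] ord0 else Move q' d (inord t))
      (mmove d p) i0 real0 o1.
  rewrite (next_confE (a1 := i0 p) (a2 := false) (a3 := o1 p) (d := dir d)
    (q' := if t.+1 <= 1 then Read q' [ffun=> false] ord0 else Move q' d (inord t))).
    by rewrite !write_id ?write_real0 /dir /mmove; case: d.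
  by rewrite /= inordK.
case: t IH tk pt e sim => [|t] IH tk pt e sim.
  apply: leads_last => //; rewrite e //=; congr (C _ _ _ _ _).
  by move: pt; rewrite /mmove; case: (d); rewrite ?addn1 ?subn1.
apply: leads_cons => //; rewrite e //=; apply: IH; first by rewrite /= ltnW.
move: pt; rewrite /mmove; case: (d) => <-; first by rewrite addSnnS.
by rewrite -subn1 -subnDA add1n.
Qed.

(** The output tape when the write-back, which runs from right to left, has reached offset [u]. *)
Let o_at u : real := fun n => if (n %/ k == h) && (u <= n %% k) then o1 n else o0 n.

Let kht t : t < k -> (k * h + t) %/ k = h /\ (k * h + t) %% k = t.
Proof.
move=> tk; rewrite mulnC divnMDl // divn_small // addn0.
by rewrite modnMDl modn_small.
Qed.

Let write_o_at t : t < k -> write (o_at t.+1) (k * h + t) (bit_at s' t) = o_at t.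
Proof.
move=> tk; apply/funext => n; rewrite writeE /o_at.
case: eqP => [->|ne].
  have [-> ->] := kht tk; rewrite eqxx leqnn /= /o1 /spread_tape.
  by have [-> ->] := kht tk; rewrite /tp' /= eqxx.
case: (n %/ k =P h) => //= nh; rewrite (leq_eqVlt t); case: eqP => //= nt.
by case: ne; rewrite (divn_eq n k) nh -nt mulnC.
Qed.

Let o_at0 : o_at 0 = o1.
Proof.
apply/funext => n; rewrite /o_at leq0n andbT; case: eqP => // nh.
by rewrite /o0 /o1 /spread_tape /tp' /=; case: eqP.
Qed.

Let o_atk : o_at k = o0.
Proof. by apply/funext => n; rewrite /o_at leqNgt ltn_mod andbF. Qed.

Let sim_o_at st p u : st <> CHalt -> simulating tp' (C st p i0 real0 (o_at u)).
Proof.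
by move=> hst; split=> // n; rewrite /= /o_at; case: ifP => _; [right|left].
Qed.

Let write_phase st t : t < k ->
  cdelta st (sym (o_at t.+1) (k * h + t)) =
    write_delta q' s' d (inord t) (sym (o_at t.+1) (k * h + t)) ->
  st <> CHalt ->
  leads (simulating tp') (C st (k * h + t) i0 real0 (o_at t.+1)) target.
Proof.
elim: t st => [|t IH] st tk dst hst.
  apply: leads_cons; first exact: sim_o_at.
  rewrite /sym /write_delta inordK // in dst.
  rewrite (next_confE dst) write_id ?write_real0 write_o_at // o_at0 addn0.
  have -> : ord_max = inord #|I| :> 'I_k by apply: val_inj; rewrite /= inordK.
  apply: move_phase; first by have := k_gt1; rewrite ltnS => ->; rewrite /=.
  rewrite /dir; case: (d) => /=; first by rewrite addSnnS mulnS addnC.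
  by rewrite -subn1 -subnDA add1n -[X in _ - X]muln1 -mulnBr subn1.
apply: leads_cons; first exact: sim_o_at.
rewrite /sym /write_delta inordK // in dst.
rewrite (next_confE dst) write_id ?write_real0 write_o_at // addnS /=.
by apply: IH => //; apply: ltnW.
Qed.

Let s := mtape c h.
Let a_at t : F := [ffun i => (rank i < t) && s i].

Let next_a t : t < k ->
  [ffun j => if rank j == t then o0 (k * h + t) else a_at t j] = a_at t.+1.
Proof.
move=> tk; apply/ffunP => j; rewrite !ffunE ltnS (leq_eqVlt (rank j)).
case: eqP => //= jt; rewrite /o0 /spread_tape.
by have [-> ->] := kht tk; rewrite /bit_at -jt track_at_rank.
Qed.

Let read_phase t st : t < k ->
  cdelta st (sym o0 (k * h + t)) =
    read_delta (mstate c) (a_at t) (inord t) (sym o0 (k * h + t)) ->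
  st <> CHalt ->
  leads (simulating tp') (C st (k * h + t) i0 real0 o0) target.
Proof.
have hcb : (mstate c == mhalt M) = false by apply/eqP.
move: {2}(#|I| - t) (erefl (#|I| - t)) => n.
elim: n t st => [|n IH] t st en tk dst hst;
  rewrite /sym /read_delta hcb inordK // next_a // in dst.
  have {en} et : t = #|I|.
    by apply/eqP; rewrite eqn_leq -ltnS tk /= -subn_eq0 en.
  have emax : inord t == ord_max :> 'I_k by rewrite -val_eqE /= inordK // et.
  have ak : a_at t.+1 = s.
    by apply/ffunP => j; rewrite ffunE et rank_lt.
  rewrite emax ak step_c in dst.
  have ot : o_at t.+1 = o0 by rewrite et o_atk.
  by rewrite -ot; apply: write_phase => //; rewrite ot.
have tI : t < #|I| by rewrite -subn_gt0 en.
have emax : (inord t == ord_max :> 'I_k) = false.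
  by rewrite -val_eqE /= inordK // ltn_eqF.
rewrite emax in dst.
have sim0 : simulating tp' (C st (k * h + t) i0 real0 o0).
  by split=> // m; left.
apply: leads_cons => //; rewrite (next_confE dst) !write_id ?write_real0 /= -addnS.
apply: IH => //; first by rewrite subnS en.
Qed.

(** The state [st] is left open because a step that begins at a limit begins in [CLim] instead of
    [Read]. *)
Lemma simulate_step st : st <> CHalt ->
  cdelta st (sym o0 (k * h)) =
    read_delta (mstate c) [ffun=> false] ord0 (sym o0 (k * h)) ->
  leads (simulating (mtape (mstep c))) (C st (k * h) i0 real0 o0)
    (spread_conf (mstep c)).
Proof.
move=> hst dst; have ea : a_at 0 = [ffun=> false].
  by apply/ffunP => j; rewrite !ffunE.
rewrite /spread_conf /mstep step_c -[X in C _ X]addn0; apply: read_phase => //.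
rewrite addn0 ea (_ : inord 0 = ord0) //.
by apply: val_inj; rewrite /= inordK.
Qed.

End SimulatedStep.

(** * The loop that spreads the input and gathers the output *)

Section Loop.
Implicit Types (P : conf SC -> Prop) (i S o : real).

Lemma walk_right P st i S o p g target : p <= g ->
  (forall n, p <= n < g -> S n = false) ->
  (forall n, P (C st n i S o)) ->
  (forall a b, cdelta st (a, false, b) = (st, (a, false, b), MoveRight)) ->
  leads P (C st g i S o) target -> leads P (C st p i S o) target.
Proof.
move=> + + PC dst; move: {2}(g - p) (erefl (g - p)) => n.
elim: n p => [|n IH] p en pg S0 gt.
  have -> // : p = g by apply/eqP; rewrite eqn_leq pg -subn_eq0 en.
have pg' : p < g by rewrite -subn_gt0 en.
apply: leads_cons => //.
have Sp : S p = false by rewrite S0 // leqnn.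
have e : cdelta st (i p, S p, o p) = (st, (i p, S p, o p), MoveRight).
  by rewrite Sp dst.
rewrite (next_confE e) !write_id; apply: IH => //; first by rewrite subnS en.
by move=> m /andP[/ltnW pm mg]; rewrite S0 ?pm.
Qed.

Lemma walk_left P st i S o p g target : g <= p ->
  (forall n, g < n <= p -> S n = false) ->
  (forall n, P (C st n i S o)) ->
  (forall a b, cdelta st (a, false, b) = (st, (a, false, b), MoveLeft)) ->
  leads P (C st g i S o) target -> leads P (C st p i S o) target.
Proof.
move=> + + PC dst gt; elim: p => [|p IH] gp S0.
  by move: gp; rewrite leqn0 => /eqP <-.
move: gp; rewrite leq_eqVlt => /orP[/eqP <- //|gp].
apply: leads_cons => //.
have Sp : S p.+1 = false by rewrite S0 // gp leqnn.
have e : cdelta st (i p.+1, S p.+1, o p.+1) = (st, (i p.+1, S p.+1, o p.+1), MoveLeft).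
  by rewrite Sp dst.
rewrite (next_confE e) !write_id; apply: IH => // m /andP[gm mp].
by rewrite S0 // gm ltnW.
Qed.

(** [Adv] makes k - 1 moves before it sets its mark, hence the start at a + 1. With a = k * j this
    shifts the far mark by one block. *)
Lemma advance P f w b i S o a target :
  (forall st n, st <> CHalt -> P (C st n i S o)) ->
  leads P (C (ToNear f w b) (a + k).-1 i (write S (a + k) true) o) target ->
  leads P (C (Adv f w b ord_max) a.+1 i S o) target.
Proof.
move=> PC at_; have walk t p : t < k -> p + t = a + k ->
    leads P (C (Adv f w b (inord t)) p i S o) target.
  elim: t p => [|t IH] p tk pt; (apply: leads_cons; first exact: PC).
    have e : cdelta (Adv f w b (inord 0)) (i p, S p, o p) =
        (ToNear f w b, (i p, true, o p), MoveLeft) by rewrite /= inordK.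
    by rewrite (next_confE e) !write_id -[in write S p _](addn0 p) pt /= -pt addn0 in at_ *.
  have e : cdelta (Adv f w b (inord t.+1)) (i p, S p, o p) =
      (Adv f w b (inord t), (i p, S p, o p), MoveRight) by rewrite /= inordK.
  rewrite (next_confE e) !write_id; apply: IH; first exact: ltnW.
  by rewrite addSnnS.
have -> : ord_max = inord #|I| :> 'I_k by apply: val_inj; rewrite /= inordK.
by apply: walk => //; rewrite addSnnS.
Qed.

(** The near cell j is not marked yet: the head stands on it, and state [Mark] will mark it. The
    mark on cell 0 stays throughout the loop and tells the limit state that a loop was running. *)
Definition marks (j : nat) : real := fun n => (n == 0) || (n == k * j).

Definition loop_conf m j i o : conf SC := C (Mark m) j i (marks j) o.

(** All exceptional cells are at least j, so a given cell is exceptional in finitely many rounds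
    only and settles before the limit. *)
Definition loop_trace (m : bool) j i o (d : conf SC) : Prop :=
  [/\ state d <> CHalt, input_tape d = i,
      forall n, n <> j -> n <> k * j -> n <> k * j.+1 ->
        scratch_tape d n = (n == 0)
    & forall n, n <> (if m then k * j else j) -> output_tape d n = o n].

Lemma loop_round m j i o : 0 < j ->
  leads (loop_trace m j i o) (loop_conf m j i o)
    (loop_conf m j.+1 i
       (if m then write o (k * j) (i j) else write o j (o (k * j)))).
Proof.
move=> j0; set o' := if m then _ else _.
have jkj : j < k * j by rewrite -[X in X < _]mul1n ltn_pmul2r // k_gt1.
have kj1 : k * j.+1 = k * j + k by rewrite mulnS addnC.
have tr st p S o1 : st <> CHalt -> (forall n, n <> j -> n <> k * j ->
      n <> k * j.+1 -> S n = (n == 0)) ->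
    (forall n, n <> (if m then k * j else j) -> o1 n = o n) ->
    loop_trace m j i o (C st p i S o1) by [].
have e1 : cdelta (Mark m) (i j, marks j j, o j) =
  (ToFar m (i j), (i j, true, o j), MoveRight) by [].
apply: leads_cons.
  by apply: tr => // n _ /eqP/negbTE nkj _; rewrite /marks nkj orbF.
rewrite (next_confE e1) !write_id /=.
pose S2 : real := fun n => [|| n == 0, n == j | n == k * j].
have -> : write (marks j) j true = S2.
  apply/funext => n; rewrite writeE /S2 /marks.
  by case: (n == j); rewrite ?orbT ?orFb.
have trS2 st p : st <> CHalt -> loop_trace m j i o (C st p i S2 o).
  move=> hst; apply: tr => // n /eqP/negbTE nj /eqP/negbTE nkj _.
  by rewrite /S2 nj nkj !orbF.
apply: (@walk_right _ _ _ _ _ _ (k * j)) => //.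
- move=> n /andP[jn nkj]; rewrite /S2 (gtn_eqF jn) (ltn_eqF nkj) !orbF.
  by rewrite gtn_eqF // (leq_trans _ jn).
- by move=> n; apply: trS2.
pose o1 := if m then write o (k * j) (i j) else o.
pose b1 := if m then i j else o (k * j).
have e2 : cdelta (ToFar m (i j)) (i (k * j), S2 (k * j), o (k * j)) =
    (Adv false m b1 ord_max, (i (k * j), false, b1), MoveRight).
  by rewrite /= /S2 eqxx !orbT.
apply: leads_cons; first exact: trS2.
rewrite (next_confE e2) !write_id.
have -> : write o (k * j) b1 = o1.
  by rewrite /o1 /b1; case: (m) => //; rewrite write_id.
pose S3 : real := fun n => (n == 0) || (n == j).
have -> : write S2 (k * j) false = S3.
  apply/funext => n; rewrite writeE /S2 /S3; case: eqP => [->|_]; last by rewrite !orbF.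
  by rewrite (gtn_eqF jkj) gtn_eqF // (leq_trans j0) // ltnW.
have o1E n : n <> (if m then k * j else j) -> o1 n = o n.
  by rewrite /o1; case: (m) => // /eqP/negbTE nkj; rewrite writeE nkj.
apply: advance => [st n hst|].
  by apply: tr => // n' /eqP/negbTE nj _ _; rewrite /S3 nj orbF.
rewrite -kj1; pose S4 := write S3 (k * j.+1) true.
have trS4 st p : st <> CHalt -> loop_trace m j i o (C st p i S4 o1).
  move=> hst; apply: tr => // n /eqP/negbTE nj _ /eqP/negbTE nkj.
  by rewrite /S4 writeE nkj /S3 nj orbF.
have jkj1 : j < k * j.+1 by rewrite kj1 (leq_trans jkj) ?leq_addr.
apply: (@walk_left _ _ _ _ _ _ j) => //.
- move=> n /andP[jn nkj]; rewrite writeE ltn_eqF; last first.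
    by rewrite (leq_ltn_trans nkj) // ltn_predL (leq_ltn_trans _ jkj1).
  by rewrite /S3 (gtn_eqF jn) gtn_eqF // (leq_ltn_trans _ jn).
- by move=> n; apply: trS4.
have e3 : cdelta (ToNear false m b1) (i j, S4 j, o1 j) =
    (Mark m, (i j, false, if m then o1 j else b1), MoveRight).
  by rewrite /= /S4 writeE (ltn_eqF jkj1) /S3 eqxx orbT.
apply: leads_last; first exact: trS4.
rewrite (next_confE e3) !write_id /loop_conf; congr C.
  apply/funext => n; rewrite /S4 !writeE /S3 /marks.
  case: (n =P j) => [->|_]; last by case: eqP; rewrite ?orbT ?orbF.
  by rewrite (ltn_eqF jkj1) gtn_eqF.
by rewrite /o' /b1 /o1; case: (m); rewrite ?write_id.
Qed.

Lemma loop_omega m i (o_ : nat -> real) o :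
  (forall r, o_ r.+1 = if m then write (o_ r) (k * r.+1) (i r.+1)
     else write (o_ r) r.+1 (o_ r (k * r.+1))) ->
  (forall r n, n <= r -> o_ r n = o n) ->
  leads (fun d => ~ program_halted d) (loop_conf m 1 i (o_ 0))
    (C CLim 0 i (fun n => n == 0) o).
Proof.
move=> oS olim.
have rd r := loop_round m i (o_ r) (ltn0Sn r).
have {}rd r : leads (loop_trace m r.+1 i (o_ r)) (loop_conf m r.+1 i (o_ r))
    (loop_conf m r.+2 i (o_ r.+1)) by rewrite oS; apply: rd.
have [f [lf fE _]] := leads_omega rd.
have kr n r : n <= r -> n < k * r.+1.
  by rewrite -ltnS => /leq_trans; apply; apply: leq_pmull.
suff <- : lim (s := SC) f = C CLim 0 i (fun n => n == 0) o.
  by apply: leadsW lf => d [r []].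
congr C; apply/funext => n; apply: fE; exists n => r nr d [_ di dS dO] /=.
- by rewrite di.
- by apply: dS; apply/eqP; rewrite ltn_eqF //; apply: kr => //; apply: leqW.
- rewrite dO ?olim //; apply/eqP; rewrite ltn_eqF //.
  by case: (m); rewrite ?kr.
Qed.

End Loop.

Lemma first_round m b i o :
  leads (fun d : conf SC => ~ program_halted d)
    (C (Adv true m b ord_max) 1 i (fun n => n == 0) o) (loop_conf m 1 i o).
Proof.
have nh st p S : st <> CHalt -> ~ program_halted (C st p i S o : conf SC) by [].
apply: (advance (a := 0)) => [st n|]; first exact: nh.
have -> : write (fun n => n == 0) (0 + k) true = marks 1.
  by apply/funext => n; rewrite writeE add0n /marks muln1; case: eqP; rewrite ?orbT ?orbF.
apply: (@walk_left _ _ _ _ _ _ 0) => //.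
  move=> n /andP[n0 nk]; rewrite /marks muln1 gtn_eqF //= ltn_eqF //.
have e : cdelta (ToNear true m b) (i 0, marks 1 0, o 0) =
  (Mark m, (i 0, marks 1 0, o 0), MoveRight) by [].
by apply: leads_last => //; rewrite (next_confE e) !write_id.
Qed.

Section Input.
Variable x : real.

(** The first step saves the bit [x 0] on output cell 0, which frees input cell 0 for recording the
    phase. *)
Let x0 : real := write x 0 false.

Let nonhalt (d : conf SC) : Prop := ~ program_halted d.

Let write0 b : write real0 0 b = fun n => (n == 0) && b.
Proof. by apply/funext => n; rewrite writeE; case: eqP. Qed.

Lemma compiled_start : leads nonhalt (start_config compiled x)
  (spread_conf x0 (mstart_conf M io x)).
Proof.
have e1 : cdelta CStart (x 0, real0 0, real0 0) =
  (Adv true true false ord_max, (false, true, x 0), MoveRight) by [].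
apply: leads_cons => //; rewrite (next_confE e1) /= write0.
(* The output tape after r rounds: blocks 0 to r have received their bits. *)
pose o_ r : real := fun n => [&& k %| n, n < k * r.+1 & x (n %/ k)].
pose o : real := fun n => (k %| n) && x (n %/ k).
have -> : write real0 0 (x 0) = o_ 0.
  apply/funext => n; rewrite writeE /o_ muln1; case: eqP => [->|/eqP n0].
    by rewrite dvdn0 div0n.
  case: (boolP (k %| n)) => //= kn; rewrite ltnNge dvdn_leq ?lt0n //.
have -> : (fun n => (n == 0) && true) = (fun n => n == 0) :> real.
  by apply/funext => n; rewrite andbT.
apply: leads_trans (first_round _ _ _ _) _.
apply: (@leads_trans SC _ _ (C CLim 0 x0 (fun n => n == 0) o)).
  apply: loop_omega => [r|r n nr].
    apply/funext => n; rewrite writeE /o_ /x0 writeE /=; case: eqP => [->|/eqP ne].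
      by rewrite dvdn_mulr // ltn_pmul2l // ltnS leqnn mulKn.
    case: (boolP (k %| n)) ne => //= /dvdnP[q ->]; rewrite mulnC.
    rewrite eqn_pmul2l // !ltn_pmul2l // => /negbTE qr.
    by rewrite (ltnS q) leq_eqVlt qr.
  rewrite /o_ (_ : n < k * r.+1) //.
  by rewrite -ltnS in nr; apply: leq_trans nr (leq_pmull _ _).
have e2 : cdelta CLim (x0 0, 0 == 0, o 0) =
  (Read (mstart M) [ffun=> false] ord0, (x0 0, false, o 0), MoveLeft) by [].
apply: leads_last => //; rewrite (next_confE (s := fun n => n == 0) e2) !write_id.
rewrite /spread_conf /= muln0; congr C.
  by apply/funext => n; rewrite writeE; case: eqP.
apply/funext => n; rewrite /spread_tape /bit_at /o /dvdn.
case: eqP => [->|nk].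
  by rewrite -rank_io track_at_rank ffunE eqxx.
case e: track_at => [j|//]; rewrite ffunE; case: eqP => // ji.
by case: nk; rewrite -(track_atP e) ji rank_io.
Qed.

Lemma compiled_finish c' : mhalted c' -> mhead c' = 0 ->
  exists2 d, halts (program_halted (p := compiled)) (spread_conf x0 c') d &
    output_tape d = fun n => mtape c' n io.
Proof.
move=> hc' hd; pose O := spread_tape (mtape c').
have hb : mstate c' == mhalt M by apply/eqP.
have e1 : cdelta (Read (mstate c') [ffun=> false] ord0) (x0 0, real0 0, O 0) =
    (Adv true false false ord_max, (true, true, O 0), MoveRight).
  by rewrite /= hb.
pose i1 := write x0 0 true.
pose O' : real := fun n => O (k * n).
have OkE : O' = fun n => mtape c' n io.
  apply/funext => n; rewrite /O' /O /spread_tape mulKn // modnMr.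
  by rewrite /bit_at -rank_io track_at_rank.
exists (C CHalt 0 i1 (fun n => n == 0) O') => //; split=> //.
apply: leads_cons => //; rewrite /spread_conf hd muln0 (next_confE e1) write_id.
have -> : write real0 0 true = fun n => n == 0.
  by rewrite write0; apply/funext => n; rewrite andbT.
rewrite -/i1 -/O; apply: leads_trans (first_round _ _ _ _) _.
(* Gathering in place is safe: cell k * (r + 1) lies beyond r, so it is unchanged when it is read.
   Cell 0 is in place from the start. *)
pose o_ r : real := fun n => if n <= r then O (k * n) else O n.
have -> : O = o_ 0.
  by apply/funext => n; rewrite /o_ leqn0; case: eqP => // ->; rewrite muln0.
apply: (@leads_trans SC _ _ (C CLim 0 i1 (fun n => n == 0) O')).
  apply: loop_omega => [r|r n nr]; last by rewrite /o_ nr.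
  apply/funext => n; rewrite writeE /o_ [k * r.+1 <= r]leqNgt leq_pmull //=.
  by rewrite (leq_eqVlt n); case: eqP => //= ->.
have e2 : cdelta CLim (i1 0, 0 == 0, O' 0) =
  (CHalt, (i1 0, 0 == 0, O' 0), MoveLeft) by [].
by apply: leads_last => //; rewrite (next_confE (s := fun n => n == 0) e2) !write_id.
Qed.

Let cell (j : idx SC) : bool + idx (multitrack_system M) :=
  match j.2 with
  | Input => inl (x0 j.1)
  | Scratch => inl false
  | Output => if track_at (j.1 %% k) is Some i then inr (j.1 %/ k, i) else inl false
  end.

Let encodes (c : conf (multitrack_system M)) (d : conf SC) : Prop :=
  d = spread_conf x0 c \/ exists2 f, c = lim f & d = lim (copy_bits cell f).

Let spread_tapeE c n :
  spread_tape (mtape c) n =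
  copy_bits cell (bit (c : conf (multitrack_system M))) (n, Output).
Proof. by rewrite /copy_bits /cell /= /spread_tape /bit_at; case: track_at. Qed.

Let encodes_bit c d j : encodes c d -> bit d j = copy_bits cell (bit c) j.
Proof.
case=> [->|[f -> ->]].
  by case: j => n [] //=; rewrite spread_tapeE.
have -> : bit (lim (s := multitrack_system M) f) = f.
  by apply/funext => -[n i] /=; rewrite ffunE.
by case: j => n [].
Qed.

Let encodes_next c d : encodes c d -> ~ mhalted c ->
  leads (fun d' => nonhalt d' /\
     forall j, bit d' j = bit d j \/
               bit d' j = copy_bits cell (bit (next_conf c)) j)
    d (spread_conf x0 (next_conf c)).
Proof.
move=> cd hc; have bitE := encodes_bit _ cd.
have [st [-> hst dst]] : exists st, [/\ d = C st (k * mhead c) x0 real0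
    (spread_tape (mtape c)), st <> CHalt &
    forall b o, cdelta st (b, false, o) =
      read_delta (mstate c) [ffun=> false] ord0 (b, false, o)].
  case: cd => [->|[f cf ->]]; first by exists (Read (mstate c) [ffun=> false] ord0).
  exists CLim; split=> //; last by rewrite cf.
  rewrite cf /= muln0; congr C; apply/funext => n.
  rewrite -[RHS]/(spread_tape (mtape (lim f : conf (multitrack_system M))) n).
  rewrite spread_tapeE; congr (copy_bits cell _ _).
  by apply/funext => -[m i] /=; rewrite ffunE.
case e : (mdelta (mstate c) (mtape c (mhead c))) => [[q' s'] dd].
have := simulate_step (i0 := x0) hc e hst (dst _ _).
apply: leadsW => d' [hd' di ds dO].
split=> // -[n []] /=; [by left; rewrite di|by left; rewrite ds|].
by rewrite -spread_tapeE; apply: dO.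
Qed.

Let encodes_lim f : encodes (lim f) (lim (copy_bits cell f)).
Proof. by right; exists f. Qed.

Let encodes_refl c : encodes c (spread_conf x0 c).
Proof. by left. Qed.

Lemma compiled_halts c' : halts (@mhalted I M) (mstart_conf M io x) c' ->
  mhead c' = 0 -> outputs compiled x (fun n => mtape c' n io).
Proof.
move=> [run_c' hc'] hd.
have [d [->|[f e _]] ld] :=
    simulate_halts encodes_refl encodes_lim encodes_bit encodes_next run_c'.
  have [d' hd' out_d'] := compiled_finish hc' hd.
  apply/outputsP; exists d' => //; apply: leads_halts compiled_start _.
  by apply: leads_halts hd'; apply: leadsW ld => ? [].
(* A halted configuration is not a limit configuration. *)
by case: (mlimit_neq_halt (m := M)); rewrite -hc' e.
Qed.

Lemma compiled_diverges : ~ (exists c', halts (@mhalted I M) (mstart_conf M io x) c') ->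
  forall y, ~ outputs compiled x y.
Proof.
move=> nh y /outputsP[d hd _]; apply: diverges_not_halts hd.
apply: leads_diverges compiled_start _.
apply: (simulate_diverges encodes_refl encodes_lim encodes_bit encodes_next) => //.
exact: mstart_neq_halt.
Qed.

End Input.

Lemma mcomputes_computable (G : real -> real -> Prop) :
  mcomputes M io G -> computable G.
Proof.
move=> MG; exists compiled => x y; have [[c' [hc' hd GE]]|[nh nG]] := MG x.
  have out := compiled_halts hc' hd; rewrite GE; split=> [<- //|out'].
  have /outputsP[d1 h1 <-] := out; have /outputsP[d2 h2 <-] := out'.
  by rewrite (halts_unique h1 h2).
by split=> [/nG|/(compiled_diverges nh)].
Qed.

End Compile.

(** * Flowcharts of programs *)

Inductive phase := Prepare | Execute | Collect.

Definition phase_code (t : phase) : option bool :=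
  match t with Prepare => None | Execute => Some false | Collect => Some true end.
Definition phase_decode (o : option bool) : phase :=
  match o with None => Prepare | Some false => Execute | Some true => Collect end.
Lemma phase_codeK : cancel phase_code phase_decode. Proof. by case. Qed.
HB.instance Definition _ := Finite.copy phase (can_type phase_codeK).

Definition tape_code (t : tape) : option bool :=
  match t with Input => None | Scratch => Some false | Output => Some true end.
Definition tape_decode (o : option bool) : tape :=
  match o with None => Input | Some false => Scratch | Some true => Output end.
Lemma tape_codeK : cancel tape_code tape_decode. Proof. by case. Qed.
HB.instance Definition _ := Finite.copy tape (can_type tape_codeK).

(* [Call a b n] at node m runs the program of node m on register a, writes its
   output into register b and goes to n. [Branch a n1 n2] tests the first bit
   of register a. *)
Inductive instruction (N reg : Type) :=
| Call (a b : reg) (n : N)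
| Branch (a : reg) (n1 n2 : N)
| Stop.
Arguments Stop {N reg}.

Section Flowchart.
Variables (N reg : finType) (prog : N -> program) (instr : N -> instruction N reg).
Variables (start limit_node : N).

Inductive track :=
| Reg (r : reg) | Sim (t : tape) | LeftEnd | Flash | Code (n : N) (ph : phase).

Definition track_code (i : track) : reg + tape + bool + N * phase :=
  match i with
  | Reg r => inl (inl (inl r))
  | Sim t => inl (inl (inr t))
  | LeftEnd => inl (inr true)
  | Flash => inl (inr false)
  | Code n ph => inr (n, ph)
  end.
Definition track_decode (s : reg + tape + bool + N * phase) : track :=
  match s with
  | inl (inl (inl r)) => Reg r
  | inl (inl (inr t)) => Sim t
  | inl (inr b) => if b then LeftEnd else Flash
  | inr (n, ph) => Code n ph
  end.
Lemma track_codeK : cancel track_code track_decode. Proof. by case. Qed.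
HB.instance Definition _ := Finite.copy track (can_type track_codeK).

Local Notation F := {ffun track -> bool}.

Definition load (a : reg) (s : F) : F := [ffun i => match i with
  | Sim Input => s (Reg a)
  | Sim _ => false
  | _ => s i
  end].

Definition store (b : reg) (s : F) : F :=
  [ffun i => if i == Reg b then s (Sim Output) else s i].

(** All other codes are cleared: at the limit of an endless chain the codes of several calls may be
    set together, and [well_formed] does not exclude this. *)
Definition set_code (n : N) (ph : phase) (s : F) : F := [ffun i => match i with
  | Code n' ph' => (n' == n) && (ph' == ph)
  | _ => s i
  end].

Definition get_code (s : F) : option (N * phase) := [pick c | s (Code c.1 c.2)].

Definition set_bit (i : track) (b : bool) (s : F) : F :=
  [ffun j => if j == i then b else s j].

Definition put (a : symbol) (s : F) : F := [ffun i => match i with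
  | Sim Input => a.1.1
  | Sim Scratch => a.1.2
  | Sim Output => a.2
  | _ => s i
  end].

Inductive fstate :=
| FStart | FLim | FHalt
| Node (n : N) | Flashed (n : N) | Loading (n : N) | Homing (n : N)
| Storing (n : N) | Running (n : N) (q : states (prog n)).

Definition fstate_code (s : fstate) :
    'I_3 + N + N + N + N + N + {n : N & states (prog n)} :=
  match s with
  | FStart => inl (inl (inl (inl (inl (inl (@inord 2 0))))))
  | FLim => inl (inl (inl (inl (inl (inl (@inord 2 1))))))
  | FHalt => inl (inl (inl (inl (inl (inl (@inord 2 2))))))
  | Node n => inl (inl (inl (inl (inl (inr n)))))
  | Flashed n => inl (inl (inl (inl (inr n))))
  | Loading n => inl (inl (inl (inr n)))
  | Homing n => inl (inl (inr n))
  | Storing n => inl (inr n)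
  | Running n q => inr (existT _ n q)
  end.
Definition fstate_decode
    (s : 'I_3 + N + N + N + N + N + {n : N & states (prog n)}) : fstate :=
  match s with
  | inl (inl (inl (inl (inl (inl i))))) =>
      if i == 0 :> nat then FStart else if i == 1 :> nat then FLim else FHalt
  | inl (inl (inl (inl (inl (inr n))))) => Node n
  | inl (inl (inl (inl (inr n)))) => Flashed n
  | inl (inl (inl (inr n))) => Loading n
  | inl (inl (inr n)) => Homing n
  | inl (inr n) => Storing n
  | inr (existT n q) => Running q
  end.
Lemma fstate_codeK : cancel fstate_code fstate_decode.
Proof. by case=> //=; rewrite inordK. Qed.
HB.instance Definition _ := Finite.copy fstate (can_type fstate_codeK).

Definition is_right (d : direction) : bool := if d is MoveRight then true else false.

Definition run_delta n (q : states (prog n)) (s : F) : fstate * F * bool :=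
  if q == halt_state (prog n) then (Homing n, s, false)
  else let: (q', a, d) :=
      delta q (s (Sim Input), s (Sim Scratch), s (Sim Output)) in
    (Running q', put a s, is_right d).

(* The internal limit state cannot tell which computation reached a limit, so
   this is recorded in cell 0. A limit of configurations in which [Flash] is
   set over and over is a limit of branchings. *)
Definition limit_delta (s : F) : fstate * F * bool :=
  if s Flash then (Node limit_node, set_bit Flash false s, false)
  else match get_code s with
  | Some (n, Prepare) => (Running (start_state (prog n)), set_code n Execute s, false)
  | Some (n, Execute) => run_delta (limit_state (prog n)) s
  | Some (n, Collect) =>
      (if instr n is Call _ _ n' then Node n' else FHalt, s, false)
  | None => (FHalt, s, false)
  end.

Definition fdelta (q : fstate) (s : F) : fstate * F * bool :=
  match q with
  | FStart => (Node start, set_bit LeftEnd true s, false)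
  | FLim => limit_delta s
  | FHalt => (FHalt, s, false)
  | Node n => match instr n with
      | Call a _ _ => (Loading n, set_code n Prepare (load a s), true)
      | Branch _ _ _ => (Flashed n, set_bit Flash true s, false)
      | Stop => (FHalt, s, false)
      end
  | Flashed n =>
      (if instr n is Branch a n1 n2 then Node (if s (Reg a) then n1 else n2)
       else FHalt, set_bit Flash false s, false)
  | Loading n =>
      (Loading n, if instr n is Call a _ _ then load a s else s, true)
  | Homing n =>
      if s LeftEnd then
        (Storing n,
         set_code n Collect (if instr n is Call _ b _ then store b s else s), true)
      else (Homing n, s, false)
  | Storing n =>
      (Storing n, if instr n is Call _ b _ then store b s else s, true)
  | Running _ q => run_delta q s
  end.

Lemma FStart_neq_halt : FStart <> FHalt. Proof. by []. Qed.
Lemma FLim_neq_halt : FLim <> FHalt. Proof. by []. Qed.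

Definition flowchart : multitrack track :=
  Multitrack FStart_neq_halt FLim_neq_halt fdelta.

Local Notation SF := (multitrack_system flowchart).
Local Notation FC := (@MConfig fstate track).

Definition node_conf (n : N) (tp : nat -> F) : conf SF := FC (Node n) 0 tp.

Definition well_formed (tp : nat -> F) : Prop :=
  (forall m, tp m LeftEnd = (m == 0)) /\ (forall m, tp m Flash = false).

Definition reg_of (tp : nat -> F) (r : reg) : real := fun m => tp m (Reg r).

Definition keeps (K : reg -> Prop) (tp : nat -> F) (d : conf SF) : Prop :=
  [/\ mstate d <> FHalt, forall m, mtape d m LeftEnd = (m == 0),
      forall m, 0 < m -> mtape d m Flash = false
    & forall r, K r -> reg_of (mtape d) r = reg_of tp r].

Lemma get_set_code n ph s : get_code (set_code n ph s) = Some (n, ph).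
Proof.
rewrite /get_code; case: pickP => [[n' ph']|/(_ (n, ph))]; rewrite ffunE.
  by case/andP=> /= /eqP-> /eqP->.
by rewrite /= !eqxx.
Qed.

Lemma next_confF q h tp q' s d : fdelta q (tp h) = (q', s, d) ->
  next_conf (FC q h tp : conf SF) = FC q' (mmove d h) [eta tp with h |-> s].
Proof.
move=> e; transitivity (let: (q1, s1, d1) := fdelta q (tp h) in
  FC q1 (mmove d1 h) [eta tp with h |-> s1]) => //.
by rewrite e.
Qed.

Lemma tape_id (tp : nat -> F) h : [eta tp with h |-> tp h] = tp :> (nat -> F).
Proof. by apply/funext => m /=; case: eqP => // ->. Qed.

(** The head passes each cell once, so all cells settle. Cell 0 is treated by the step before the
    sweep, which starts on cell 1. *)
Lemma sweep (P : conf SF -> Prop) q (phi : F -> F) tp :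
  (forall s, fdelta q s = (q, phi s, true)) ->
  (forall h tp', (forall m, tp' m = tp m \/ tp' m = phi (tp m)) -> P (FC q h tp')) ->
  leads P (FC q 1 tp)
    (FC FLim 0 (fun m => if m == 0 then tp 0 else phi (tp m))).
Proof.
move=> dq HP.
pose mix r : nat -> F := fun m => if 0 < m < r then phi (tp m) else tp m.
have [|f [lf fE _]] := @leads_omega SF (fun r d => d = FC q r.+1 (mix r.+1))
    (fun r => FC q r.+1 (mix r.+1)).
  move=> r; apply: leads_last => //.
  rewrite (next_confF (dq _)) /mmove; congr MConfig; apply/funext => m /=.
  rewrite /mix ltnn andbF; case: eqP => [->|/eqP/negbTE ne]; first by rewrite ltnSn.
  by rewrite (ltnS m r.+1) (leq_eqVlt m) ne.
have <- : lim (s := SF) f = FC FLim 0 (fun m => if m == 0 then tp 0 else phi (tp m)).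
  congr MConfig; apply/funext => m; apply/ffunP => i; rewrite ffunE.
  apply: fE; exists m => r mr _ -> /=; rewrite /mix ltnS mr andbT lt0n.
  by case: eqP => //= ->.
have <- : mix 1 = tp by apply/funext => m; rewrite /mix ltnS; case: m.
apply: leadsW lf => d [r ->]; apply: HP => m.
by rewrite /mix; case: ifP => _; [right|left].
Qed.

Lemma home (P : conf SF -> Prop) n h (tp : nat -> F) target :
  (forall m, tp m LeftEnd = (m == 0)) -> (forall h, P (FC (Homing n) h tp)) ->
  leads P (FC (Homing n) 0 tp) target -> leads P (FC (Homing n) h tp) target.
Proof.
move=> LE HP H0; elim: h => // h IH; apply: leads_cons => //.
have e : fdelta (Homing n) (tp h.+1) = (Homing n, tp h.+1, false).
  by rewrite /= LE.
by rewrite (next_confF e) tape_id.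
Qed.

Lemma flash_step n a n1 n2 (tp : nat -> F) : instr n = Branch a n1 n2 ->
  next_conf (node_conf n tp) =
    FC (Flashed n) 0 [eta tp with 0 |-> set_bit Flash true (tp 0)].
Proof.
move=> e; have d : fdelta (Node n) (tp 0) = (Flashed n, set_bit Flash true (tp 0), false).
  by rewrite /= e.
by rewrite (next_confF d).
Qed.

Lemma branch_step n a n1 n2 tp : instr n = Branch a n1 n2 -> well_formed tp ->
  next_conf (FC (Flashed n) 0 [eta tp with 0 |-> set_bit Flash true (tp 0)] : conf SF) =
    node_conf (if reg_of tp a 0 then n1 else n2) tp.
Proof.
move=> e [_ fl]; pose tp' : nat -> F := [eta tp with 0 |-> set_bit Flash true (tp 0)].
have d : fdelta (Flashed n) (tp' 0) =
    (Node (if reg_of tp a 0 then n1 else n2), tp 0, false).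
  rewrite /= e; congr (Node _, _, _); first by rewrite /set_bit ffunE.
  by apply/ffunP => i; rewrite !ffunE; case: (i =P Flash) => // ->; rewrite fl.
rewrite (next_confF d); congr MConfig; apply/funext => m /=.
by rewrite /tp' /=; case: (m =P 0) => // ->.
Qed.

Lemma stop_step n tp : instr n = Stop ->
  next_conf (node_conf n tp) = FC FHalt 0 tp.
Proof.
move=> e; have d : fdelta (Node n) (tp 0) = (FHalt, tp 0, false) by rewrite /= e.
by rewrite (next_confF d) tape_id.
Qed.

(** * Calling a program *)

Section Call.
Variables (n : N) (a b : reg) (n' : N) (tp : nat -> F).
Hypothesis instr_n : instr n = Call a b n'.
Hypothesis wf : well_formed tp.

Let K r := r <> b.

Let loaded (ph : phase) : nat -> F :=
  fun m => if m == 0 then set_code n ph (load a (tp 0)) else load a (tp m).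

Let loadedE ph m i : loaded ph m i =
  if m == 0 then set_code n ph (load a (tp 0)) i else load a (tp m) i.
Proof. by rewrite /loaded; case: eqP. Qed.

Let loaded_const ph m : [/\ loaded ph m LeftEnd = (m == 0),
  loaded ph m Flash = false & forall r, loaded ph m (Reg r) = tp m (Reg r)].
Proof.
by split=> [||r]; rewrite loadedE /load !ffunE ?wf.1 ?wf.2; case: eqP => // ->.
Qed.

Definition run_conf (c : conf (program_system (prog n))) : conf SF :=
  FC (Running (state c)) (Defs.head c) (fun m =>
    put (input_tape c m, scratch_tape c m, output_tape c m) (loaded Execute m)).

Let keepsK q h (tp' : nat -> F) : q <> FHalt ->
  (forall m, [/\ tp' m LeftEnd = (m == 0), tp' m Flash = false
     & forall r, r <> b -> tp' m (Reg r) = tp m (Reg r)]) ->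
  keeps K tp (FC q h tp').
Proof.
move=> hq H; split=> //= [m|m _|r rb]; [by case: (H m)|by case: (H m)|].
by apply/funext => m; have [_ _] := H m; apply.
Qed.

Lemma call_start :
  leads (keeps K tp) (node_conf n tp) (run_conf (start_config (prog n) (reg_of tp a))).
Proof.
have e1 : fdelta (Node n) (tp 0) = (Loading n, set_code n Prepare (load a (tp 0)), true).
  by rewrite /= instr_n.
apply: leads_cons; first by apply: keepsK => // m; rewrite wf.1 wf.2.
rewrite (next_confF e1) /=.
set tp1 : nat -> F := [eta tp with 0 |-> _].
have e2 s : fdelta (Loading n) s = (Loading n, load a s, true) by rewrite /= instr_n.
have tp1E m : [/\ tp1 m LeftEnd = (m == 0), tp1 m Flash = false &
    forall r, tp1 m (Reg r) = tp m (Reg r)].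
  have LE := wf.1 m; have FL := wf.2 m; rewrite /tp1 /=.
  by case: eqP LE FL => [->|_] LE FL; split=> [||r]; rewrite ?ffunE.
apply: leads_trans (sweep e2 _) _ => [h tp' Htp'|].
  apply: keepsK => // m; have [LE FL RE] := tp1E m.
  by case: (Htp' m) => ->; split=> // [||r _]; rewrite ?ffunE ?LE ?FL.
have -> : (fun m => if m == 0 then tp1 0 else load a (tp1 m)) = loaded Prepare.
  by apply/funext => m; rewrite /loaded /tp1 /=; case: eqP.
have e3 : fdelta FLim (loaded Prepare 0) =
    (Running (start_state (prog n)), loaded Execute 0, false).
  have [_ fl _] := loaded_const Prepare 0; rewrite /= /limit_delta fl /loaded /=.
  by rewrite get_set_code; congr (_, _, _); apply/ffunP => i; rewrite !ffunE; case: i.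
apply: leads_last.
  by apply: keepsK => // m; have [-> -> H] := loaded_const Prepare m.
rewrite (next_confF e3); congr MConfig; apply/funext => m /=.
apply/ffunP => i; rewrite /put ffunE /=.
have -> : (if m == 0 then loaded Execute 0 else loaded Prepare m) = loaded Execute m.
  by rewrite /loaded; case: eqP => // ->.
by case: i => // -[]; rewrite loadedE !ffunE; case: eqP => // ->.
Qed.

Let cell (j : idx SF) : bool + idx (program_system (prog n)) :=
  if j.2 is Sim t then inr (j.1, t) else inl (loaded Execute j.1 j.2).

Let encodes (c : conf (program_system (prog n))) (d : conf SF) : Prop :=
  d = run_conf c \/ exists2 f, c = lim f & d = lim (copy_bits cell f).

Let encodes_tape c d m : encodes c d -> mtape d m =
  put (input_tape c m, scratch_tape c m, output_tape c m) (loaded Execute m).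
Proof.
case=> [-> //|[f -> ->]]; apply/ffunP => i; rewrite /= /put !ffunE /=.
by case: i => // -[].
Qed.

Let encodes_bit c d j : encodes c d -> bit d j = copy_bits cell (bit c) j.
Proof.
move=> cd; rewrite /= (encodes_tape _ cd) /put ffunE /copy_bits /cell.
by case: j => m [] // [].
Qed.

Let encodes_lim f : encodes (lim f) (lim (copy_bits cell f)).
Proof. by right; exists f. Qed.

Let encodes_refl c : encodes c (run_conf c).
Proof. by left. Qed.

Let encodes_next c d : encodes c d -> ~ program_halted c ->
  leads (fun d' : conf SF => mstate d' <> FHalt /\
     forall j, bit d' j = bit d j \/
               bit d' j = copy_bits cell (bit (next_conf c)) j)
    d (run_conf (next_conf c)).
Proof.
move=> cd hc.
have [q [dE hq dq]] : exists q, [/\ d = FC q (Defs.head c) (fun m =>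
    put (input_tape c m, scratch_tape c m, output_tape c m) (loaded Execute m)),
    q <> FHalt & fdelta q (mtape d (Defs.head c)) =
      run_delta (state c) (mtape d (Defs.head c))].
  have dE : d = FC (mstate d) (mhead d) (fun m =>
    put (input_tape c m, scratch_tape c m, output_tape c m) (loaded Execute m)).
    case: d cd => q h tpd cd; congr MConfig; apply/funext => m.
    exact: encodes_tape cd.
  case: (cd) => [dc|[f cf df]].
    by exists (Running (state c)); split=> //; rewrite dc.
  exists FLim; rewrite {1}dE df cf; split=> //.
  rewrite -df -cf /= (encodes_tape _ cd) cf /=.
  rewrite /limit_delta /put ffunE /=; have [_ -> _] := loaded_const Execute 0.
  rewrite (_ : get_code _ = Some (n, Execute)) //.
  rewrite -(get_set_code n Execute (load a (tp 0))); apply: eq_pick => -[n1 ph1].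
  by rewrite ffunE loadedE.
have dq' := dq; rewrite (encodes_tape _ cd) in dq'.
apply: leads_last; first by split=> [|j]; [rewrite dE|left].
rewrite dE {dq dE}; set tpc : nat -> F := fun m => put _ _.
rewrite -/(tpc (Defs.head c)) in dq'.
move: dq'; rewrite /run_delta; case: eqP => [/hc //|_].
have -> : (tpc (Defs.head c) (Sim Input), tpc (Defs.head c) (Sim Scratch),
    tpc (Defs.head c) (Sim Output)) = (input_tape c (Defs.head c),
    scratch_tape c (Defs.head c), output_tape c (Defs.head c)).
  by rewrite /tpc /put !ffunE.
case e: delta => [[q' [[a1 a2] a3]] dd] dq'.
rewrite (next_confF dq') /run_conf /= /step e /=; congr MConfig.
  by rewrite /mmove; case: (dd).
apply/funext => m /=; rewrite /write /=.
by case: eqP => // ->; apply/ffunP => i; rewrite /tpc /put !ffunE; case: i => // -[].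
Qed.

Lemma call_halts y : outputs (prog n) (reg_of tp a) y ->
  exists tp', [/\ well_formed tp', reg_of tp' b = y,
    forall r, r <> b -> reg_of tp' r = reg_of tp r
    & leads (keeps K tp) (node_conf n tp) (node_conf n' tp')].
Proof.
move=> /outputsP[c' [run_c' hc'] <-].
have [d [->|[f e _]] ld] :=
    simulate_halts encodes_refl encodes_lim encodes_bit encodes_next run_c'; last first.
  by case: (@limit_neq_halt (prog n)); rewrite -hc' e.
have {}ld : leads (keeps K tp)
    (run_conf (start_config (prog n) (reg_of tp a))) (run_conf c').
  apply: leadsW ld => -[q h tp'] [hq Hc] /=.
  apply: keepsK => // m; have [LE FL RE] := loaded_const Execute m.
  split; first by have /= -> := Hc (m, LeftEnd).
    by have /= -> := Hc (m, Flash).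
  by move=> r _; have /= -> := Hc (m, Reg r).
pose tp1 : nat -> F := fun m =>
  put (input_tape c' m, scratch_tape c' m, output_tape c' m) (loaded Execute m).
have tp1E m : [/\ tp1 m LeftEnd = (m == 0), tp1 m Flash = false &
    forall r, tp1 m (Reg r) = tp m (Reg r)].
  have [LE FL RE] := loaded_const Execute m.
  by rewrite /tp1 /put; split=> [||r]; rewrite ffunE.
pose tp2 : nat -> F := fun m =>
  if m == 0 then set_code n Collect (store b (tp1 0)) else store b (tp1 m).
have tp2E m i : (forall n ph, i <> Code n ph) -> tp2 m i = store b (tp1 m) i.
  move=> nC; rewrite /tp2; case: eqP => // ->; rewrite ffunE.
  by case: i nC => // n1 ph /(_ n1 ph).
have storeE m : [/\ store b (tp1 m) LeftEnd = (m == 0),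
    store b (tp1 m) Flash = false &
    forall r, r <> b -> store b (tp1 m) (Reg r) = tp m (Reg r)].
  have [LE FL RE] := tp1E m; split=> [||r rb]; rewrite ffunE //.
  by case: eqP => // -[].
exists tp2; split.
- by split=> m; rewrite tp2E //; case: (storeE m).
- apply/funext => m; rewrite /reg_of tp2E // ffunE eqxx.
  by rewrite /tp1 /put ffunE.
- by move=> r rb; apply/funext => m; rewrite /reg_of tp2E //; case: (storeE m) => _ _; apply.
apply: leads_trans call_start _; apply: leads_trans ld _.
have kp1 q h : q <> FHalt -> keeps K tp (FC q h tp1).
  by move=> hq; apply: keepsK => // m; have [LE FL RE] := tp1E m; split.
have hb : state c' == halt_state (prog n) by apply/eqP.
have e1 : fdelta (Running (state c')) (tp1 (Defs.head c')) =
    (Homing n, tp1 (Defs.head c'), false) by rewrite /= /run_delta hb.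
apply: leads_cons; first exact: kp1.
rewrite (next_confF e1) tape_id.
apply: home => [m|h|]; [by case: (tp1E m)|exact: kp1|].
have e2 : fdelta (Homing n) (tp1 0) =
    (Storing n, set_code n Collect (store b (tp1 0)), true).
  by have [LE _ _] := tp1E 0; rewrite /= LE instr_n.
apply: leads_cons; first exact: kp1.
rewrite (next_confF e2) /=.
set tp3 : nat -> F := [eta tp1 with 0 |-> _].
have e3 s : fdelta (Storing n) s = (Storing n, store b s, true) by rewrite /= instr_n.
have tp3E m : [/\ tp3 m LeftEnd = (m == 0), tp3 m Flash = false &
    forall r, r <> b -> tp3 m (Reg r) = tp m (Reg r)].
  have [LE FL RE] := tp1E m; have [LE' FL' RE'] := storeE m.
  rewrite /tp3 /=; case: eqP LE LE' FL' RE' => [->|_] // _ LE' FL' RE'.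
  by split=> [||r rb]; rewrite ffunE //; apply: RE'.
apply: leads_trans (sweep e3 _) _ => [h tp' Htp'|].
  apply: keepsK => // m; have [LE FL RE] := tp3E m.
  case: (Htp' m) => ->; first by [].
  split=> [||r rb]; rewrite ffunE //.
  by case: eqP => [[]//|_]; apply: RE.
have -> : (fun m => if m == 0 then tp3 0 else store b (tp3 m)) = tp2.
  by apply/funext => m; rewrite /tp3 /tp2 /=; case: eqP.
(* The sweep ends in the limit state, and the code [Collect] in cell 0 directs it to the next
   node. *)
have e4 : fdelta FLim (tp2 0) = (Node n', tp2 0, false).
  have [LE FL RE] := storeE 0.
  rewrite /= /limit_delta tp2E // FL {1}/tp2 /= get_set_code instr_n //.
apply: leads_last; last by rewrite (next_confF e4) tape_id.
apply: keepsK => // m; have [LE FL RE] := storeE m.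
by rewrite !tp2E //; split=> // r rb; rewrite tp2E // RE.
Qed.

Lemma call_diverges : (forall y, ~ outputs (prog n) (reg_of tp a) y) ->
  diverges (@mhalted _ flowchart) (node_conf n tp).
Proof.
move=> nout.
apply: (@leads_diverges _ _ _ (run_conf (start_config (prog n) (reg_of tp a)))).
  by apply: leadsW call_start => d [].
apply: (simulate_diverges encodes_refl encodes_lim encodes_bit encodes_next) => //.
  exact: start_neq_halt.
by case=> c' hc'; apply: (nout (output_tape c')); apply/outputsP; exists c'.
Qed.

End Call.

End Flowchart.

(** * The chain of preimages *)

Inductive register := Origin | Current | Answer.

Definition register_code (r : register) : option bool :=
  match r with Origin => None | Current => Some false | Answer => Some true end.
Definition register_decode (o : option bool) : register :=
  match o with None => Origin | Some false => Current | Some true => Answer end.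
Lemma register_codeK : cancel register_code register_decode. Proof. by case. Qed.
HB.instance Definition _ := Finite.copy register (can_type register_codeK).

(* The boolean of a node is the side of the element under examination; the
   register is the one that holds this element. *)
Inductive node :=
| Domain | Done | Final (s : bool)
| Test (s : bool) (r : register)
| Check (s : bool) (r : register)
| Invert (s : bool) (r : register).

Definition node_code (n : node) :
    bool + bool + bool * register + bool * register + bool * register :=
  match n with
  | Domain => inl (inl (inl (inl true)))
  | Done => inl (inl (inl (inl false)))
  | Final s => inl (inl (inl (inr s)))
  | Test s r => inl (inl (inr (s, r)))
  | Check s r => inl (inr (s, r))
  | Invert s r => inr (s, r)
  end.
Definition node_decode
    (c : bool + bool + bool * register + bool * register + bool * register) : node :=
  match c with
  | inl (inl (inl (inl b))) => if b then Domain else Done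
  | inl (inl (inl (inr s))) => Final s
  | inl (inl (inr (s, r))) => Test s r
  | inl (inr (s, r)) => Check s r
  | inr (s, r) => Invert s r
  end.
Lemma node_codeK : cancel node_code node_decode. Proof. by case. Qed.
HB.instance Definition _ := Finite.copy node (can_type node_codeK).

Section Chains.
Variables (D : bool -> set real) (prev : bool -> real -> real).

(* Going backwards from z on side s, the chain of z stops on side t. *)
Inductive stops (t : bool) : bool -> real -> Prop :=
| stops_here z : ~ D t z -> stops t t z
| stops_back s z : D s z -> stops t (~~ s) (prev s z) -> stops t s z.

Variables (dom : set real) (s0 : bool).
Variables (p_dom : program) (p_test p_prev p_final : bool -> program).
Hypothesis p_domP : forall x y, graph dom (fun=> real1) x y <-> outputs p_dom x y.
Hypothesis p_testP : forall s z, outputs (p_test s) z (char_fun (D s) z).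
Hypothesis p_prevP : forall s z, D s z -> outputs (p_prev s) z (prev s z).

Definition chain_prog (n : node) : program :=
  match n with
  | Test s _ => p_test s
  | Invert s _ => p_prev s
  | Final s => p_final s
  | _ => p_dom
  end.

Definition chain_instr (n : node) : instruction node register :=
  match n with
  | Domain => Call Origin Answer (Test s0 Origin)
  | Test s r => Call r Answer (Check s r)
  | Check s r => Branch Answer (Invert s r) (Final s)
  | Invert s r => Call r Current (Test (~~ s) Current)
  | Final s => Call Origin Origin Done
  | Done => Stop
  end.

(** An endless chain does not stop on side [true], so its limit is sent to the same final call as
    chains that stop on side [false]. *)
Definition chain_machine := flowchart chain_prog chain_instr Domain (Final false).

Local Notation SF := (multitrack_system chain_machine).
Local Notation F := {ffun track node register -> bool}.
Local Notation FC := (@MConfig (fstate chain_prog) (track node register)).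
Local Notation nodec :=
  (@node_conf node register chain_prog chain_instr Domain (Final false)).
Local Notation flash tp := [eta tp with 0 |-> set_bit (Flash node register) true (tp 0)].
Local Notation nonhalt := (fun d : conf SF => ~ mhalted d).

Definition flashed (n : node) (tp : nat -> F) : conf SF :=
  FC (Flashed chain_prog n) 0 (flash tp).

Section Trace.
Variable x : real.

(** An invariant of whole rounds that settles, at their limit, the cells needed afterwards. It is
    silent on [Flash] in cell 0, which each branching changes. *)
Definition keeps_origin (d : conf SF) : Prop :=
  [/\ ~ mhalted d, forall m, mtape d m (LeftEnd _ _) = (m == 0),
      forall m, 0 < m -> mtape d m (Flash _ _) = false
    & reg_of (mtape d) Origin = x].

(** At the limit of the rounds [Current] and [Answer] may have changed infinitely often; the final
    call reads only [Origin]. *)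
Definition ready (tp : nat -> F) : Prop :=
  well_formed tp /\ reg_of tp Origin = x.

Lemma keeps_keeps_origin b tp d : b <> Origin -> reg_of tp Origin = x ->
  keeps (fun r => r <> b) tp d -> keeps_origin d.
Proof.
by move=> b0 ox [hq LE FL RE]; split=> //; rewrite RE ?ox //; apply: nesym.
Qed.

Lemma ready_keeps_origin q tp : q <> FHalt _ -> ready tp ->
  keeps_origin (FC q 0 tp) /\ keeps_origin (FC q 0 (flash tp)).
Proof.
move=> hq [[LE FL] ox]; split; split=> //= [m|m m0|].
- by case: eqP (LE m) => [->|_] e; rewrite ?ffunE.
- by rewrite gtn_eqF.
- apply/funext => m; rewrite -ox /reg_of /=.
  by case: eqP => // ->; rewrite ffunE.
Qed.

Lemma test_step s r z tp : r <> Answer -> ready tp -> reg_of tp r = z ->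
  exists tp', [/\ ready tp', reg_of tp' r = z, reg_of tp' Answer 0 = (z \in D s)
    & leads keeps_origin (nodec (Test s r) tp) (flashed (Check s r) tp')].
Proof.
move=> rA [wf ox] rz; have out := p_testP s z.
rewrite -rz in out.
have [tp' [wf' ans keep ld]] := @call_halts _ _ chain_prog chain_instr Domain
  (Final false) (Test s r) _ _ _ _ (erefl _) wf _ out.
have rd' : ready tp' by split=> //; rewrite keep.
exists tp'; split=> //; [by rewrite keep|by rewrite ans rz /char_fun; case: ifP|].
apply: leads_trans (leadsW _ ld) _; first by move=> d; apply: keeps_keeps_origin.
apply: leads_last; last exact: flash_step.
by have [] := @ready_keeps_origin (Node _ (Check s r)) tp' _ rd'.
Qed.

Lemma check_step s r tp : ready tp ->
  leads keeps_origin (flashed (Check s r) tp)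
    (nodec (if reg_of tp Answer 0 then Invert s r else Final s) tp).
Proof.
move=> rd; apply: leads_last; last first.
  exact: (@branch_step _ _ _ chain_instr _ _ (Check s r) _ _ _ _ (erefl _) rd.1).
by have [] := @ready_keeps_origin (Flashed _ (Check s r)) tp _ rd.
Qed.

Lemma invert_step s r z tp : r <> Answer -> ready tp -> reg_of tp r = z -> D s z ->
  exists tp', [/\ ready tp', reg_of tp' Current = prev s z
    & leads keeps_origin (nodec (Invert s r) tp) (nodec (Test (~~ s) Current) tp')].
Proof.
move=> rA [wf ox] rz Dz; have out := p_prevP Dz; rewrite -rz in out.
have [tp' [wf' ans keep ld]] := @call_halts _ _ chain_prog chain_instr Domain
  (Final false) (Invert s r) _ _ _ _ (erefl _) wf _ out.
exists tp'; split=> //; [by split=> //; rewrite keep|by rewrite ans rz|].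
by apply: leadsW ld => d; apply: keeps_keeps_origin.
Qed.

Lemma stops_leads t s z : stops t s z ->
  forall r tp, r <> Answer -> ready tp -> reg_of tp r = z ->
  exists2 tp', ready tp' &
    leads keeps_origin (nodec (Test s r) tp) (nodec (Final t) tp').
Proof.
elim=> {s z} [z nDz|s z Dz _ IH] r tp rA rd rz.
  have [tp' [rd' rz' ans ld]] := test_step t rA rd rz.
  exists tp' => //; apply: leads_trans ld _.
  have := @check_step t r tp' rd'; rewrite ans ifF //.
  by apply/negbTE; rewrite notin_setE.
have [tp1 [rd1 rz1 ans1 ld1]] := test_step s rA rd rz.
have [tp2 [rd2 rz2 ld2]] := invert_step rA rd1 rz1 Dz.
have [//|tp3 rd3 ld3] := IH Current tp2 _ rd2 rz2.
exists tp3 => //; apply: leads_trans ld1 _.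
have := @check_step s r tp1 rd1; rewrite ans1 mem_set // => ld.
by apply: leads_trans ld _; apply: leads_trans ld2 _.
Qed.

Definition endless (s : bool) (z : real) : Prop := forall t, ~ stops t s z.

Lemma endless_back s z : endless s z -> D s z /\ endless (~~ s) (prev s z).
Proof.
move=> es; have Dz : D s z by apply: contrapT => nDz; apply: (es s); apply: stops_here.
by split=> // t st; apply: (es t); apply: stops_back.
Qed.

(** Rounds are cut at the moment when [Flash] is set, because the last clause of [leads_omega] looks
    only at the first configuration of each round. *)
Definition endless_conf (d : conf SF) : Prop :=
  exists s r z tp, [/\ d = flashed (Check s r) tp, r <> Answer, ready tp,
    reg_of tp r = z & reg_of tp Answer 0 /\ endless s z].

Lemma endless_conf_next d : endless_conf d ->
  exists2 d', endless_conf d' & leads keeps_origin d d'.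
Proof.
move=> [s [r [z [tp [-> rA rd rz [ans es]]]]]].
have [Dz es'] := endless_back es.
have := @check_step s r tp rd; rewrite ans => ld1.
have [tp2 [rd2 rz2 ld2]] := invert_step rA rd rz Dz.
have cA : Current <> Answer by [].
have [tp3 [rd3 rz3 ans3 ld3]] := test_step (~~ s) cA rd2 rz2.
exists (flashed (Check (~~ s) Current) tp3).
  exists (~~ s), Current, (prev s z), tp3; split=> //; split=> //.
  by rewrite ans3 mem_set //; have [] := endless_back es'.
by apply: leads_trans ld1 _; apply: leads_trans ld2 _.
Qed.

Lemma endless_leads s z r tp : endless s z -> r <> Answer -> ready tp ->
  reg_of tp r = z ->
  exists2 tp', ready tp' &
    leads nonhalt (nodec (Test s r) tp) (nodec (Final false) tp').
Proof.
move=> es rA rd rz.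
have [tp1 [rd1 rz1 ans1 ld1]] := test_step s rA rd rz.
have d0 : endless_conf (flashed (Check s r) tp1).
  exists s, r, z, tp1; split=> //; split=> //.
  by rewrite ans1 mem_set //; have [] := endless_back es.
have [d|G GP] := @choice _ _ (fun d d' => endless_conf d ->
    endless_conf d' /\ leads keeps_origin d d').
  have [/endless_conf_next[d' ed' ld']|ned] := pselect (endless_conf d).
    by exists d'.
  by exists d.
pose sq n := iter n G (flashed (Check s r) tp1).
have sqP n : endless_conf (sq n) by elim: n => //= n /GP[].
have sqld n : leads keeps_origin (sq n) (sq n.+1) by have [] := GP _ (sqP n).
have [f [lf fE fT]] := leads_omega sqld.
have flash0 : f (0, Flash _ _).
  apply: fT => N; exists N => //; have [s' [r' [z' [tp' [-> _ _ _ _]]]]] := sqP N.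
  by rewrite /= ffunE eqxx.
pose tpf : nat -> F := fun m => [ffun i => f (m, i)].
pose tp' : nat -> F := [eta tpf with 0 |-> set_bit (Flash _ _) false (tpf 0)].
have rd' : ready tp'.
  split; first split=> m.
  - have LE : f (m, LeftEnd _ _) = (m == 0).
      by apply: fE; exists 0 => n _ d [_ LE _ _]; apply: LE.
    by rewrite -LE /tp' /=; case: eqP LE => [->|_] LE; rewrite !ffunE.
  - rewrite /tp' /=; case: (m =P 0) => [_|/eqP m0]; rewrite ffunE ?eqxx //.
    by apply: fE; exists 0 => n _ d [_ _ FL _]; apply: FL; rewrite lt0n.
  - apply/funext => m; have RE : f (m, Reg _ Origin) = x m.
      by apply: fE; exists 0 => n _ d [_ _ _ dx]; rewrite -[RHS]/(x m) -dx.
    by rewrite -RE /reg_of /tp' /=; case: eqP RE => [->|_] RE; rewrite !ffunE.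
exists tp' => //.
have dl : fdelta chain_instr Domain (Final false) (FLim chain_prog) (tpf 0) =
    (Node _ (Final false), set_bit (Flash _ _) false (tpf 0), false).
  by rewrite /= /limit_delta ffunE flash0.
apply: (leads_trans (leadsW _ ld1)); first by move=> d [].
apply: (leads_trans (leadsW _ lf)); first by move=> d [_ []].
by apply: leads_last => //; rewrite (next_confF dl).
Qed.

Lemma final_halts t tp y : ready tp -> outputs (p_final t) x y ->
  exists c', [/\ halts (@mhalted _ chain_machine) (nodec (Final t) tp) c',
    mhead c' = 0 & reg_of (mtape c') Origin = y].
Proof.
move=> [wf ox] out; rewrite -ox in out.
have [tp' [wf' ans keep ld]] := @call_halts _ _ chain_prog chain_instr Domain
  (Final false) (Final t) _ _ _ _ (erefl _) wf _ out.
exists (FC (FHalt _) 0 tp'); split=> //; split=> //.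
apply: leads_trans (leadsW _ ld) _; first by move=> d [].
by apply: leads_last => //; apply: stop_step.
Qed.

Lemma domain_start : exists2 tp, ready tp &
  leads nonhalt (mstart_conf chain_machine (Reg _ Origin) x) (nodec Domain tp).
Proof.
pose tp0 : nat -> F := fun n => [ffun i => (i == Reg _ Origin) && x n].
pose tp : nat -> F := [eta tp0 with 0 |-> set_bit (LeftEnd _ _) true (tp0 0)].
have dl : fdelta chain_instr Domain (Final false) (FStart chain_prog) (tp0 0) =
  (Node _ Domain, set_bit (LeftEnd _ _) true (tp0 0), false) by [].
exists tp; last by apply: leads_last => //; rewrite (next_confF dl).
split; first split=> m.
- by rewrite /tp /=; case: eqP => _; rewrite !ffunE ?eqxx.
- by rewrite /tp /=; case: eqP => _; rewrite !ffunE.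
- apply/funext => m; rewrite /reg_of /tp /=.
  by case: eqP => [->|_]; rewrite !ffunE eqxx.
Qed.

End Trace.

(** Outside [dom] the opening call never returns. On [dom] every call returns, and endless chains
    are left through the limit node. *)
Theorem chain_computable (G : real -> real -> Prop) :
  (forall x, dom x -> exists2 y, outputs (p_final `[< stops true s0 x >]) x y &
     forall y', G x y' <-> y = y') ->
  (forall x y, G x y -> dom x) ->
  computable G.
Proof.
move=> Gdom domG; apply: (@mcomputes_computable _ chain_machine (Reg _ Origin)) => x.
have [tp [wf ox] ld] := domain_start x.
have [xd|nxd] := pselect (dom x); last first.
  right; split; last by move=> y /domG.
  case=> c'; apply: diverges_not_halts; apply: leads_diverges ld _.
  apply: (@call_diverges _ _ chain_prog chain_instr Domain
    (Final false) Domain _ _ _ _ (erefl _) wf) => y.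
  by rewrite ox => /p_domP[].
left; have [y out Gy] := Gdom x xd.
have /p_domP out1 : graph dom (fun=> real1) x real1 by split.
rewrite -[X in outputs _ X]ox in out1.
have [tp1 [wf1 _ keep ld1]] := @call_halts _ _ chain_prog chain_instr Domain
  (Final false) Domain _ _ _ _ (erefl _) wf _ out1.
have ox1 : reg_of tp1 Origin = x by rewrite keep.
have [tp2 rd2 ld2] : exists2 tp2, ready x tp2 &
    leads nonhalt (nodec (Test s0 Origin) tp1) (nodec (Final `[< stops true s0 x >]) tp2).
  case: (pselect (stops true s0 x)) => [st|nst].
    rewrite asboolT //.
    have [//|tp2 rd2 ld2] := stops_leads st (r := Origin) _ (conj wf1 ox1) ox1.
    by exists tp2 => //; apply: leadsW ld2 => d [].
  rewrite asboolF //; case: (pselect (stops false s0 x)) => [st|nst'].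
    have [//|tp2 rd2 ld2] := stops_leads st (r := Origin) _ (conj wf1 ox1) ox1.
    by exists tp2 => //; apply: leadsW ld2 => d [].
  by apply: (@endless_leads x s0 x) => //; case.
have [c' [hc' hd cy]] := final_halts rd2 out.
exists c'; split=> // [|y']; last by rewrite Gy -cy.
apply: leads_halts ld _; apply: leads_halts (leadsW _ ld1) _; first by move=> d [].
exact: leads_halts ld2 hc'.
Qed.

End Chains.

(** * The bijection and its inverse *)

Lemma preimage_choice (A : set real) (f : real -> real) :
  exists finv, forall y, (f @` A) y -> A (finv y) /\ f (finv y) = y.
Proof.
have [y|finv finvP] := @choice _ _ (fun y x => (f @` A) y -> A x /\ f x = y).
  have [[x Ax fx]|ny] := pselect ((f @` A) y); first by exists x.
  by exists real0.
by exists finv.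
Qed.

Theorem theorem46 (A B : set real) (f g : real -> real)
    (sdA : semi_decidable_set A) (sdB : semi_decidable_set B)
    (fAB : set_fun A B f) (f_inj : set_inj A f)
    (f_comp : computable (graph A f))
    (finv_comp : computable (graph_inv (graph A f)))
    (f_ran : decidable_set (f @` A))
    (gBA : set_fun B A g) (g_inj : set_inj B g)
    (g_comp : computable (graph B g))
    (ginv_comp : computable (graph_inv (graph B g)))
    (g_ran : decidable_set (g @` B)) :
  exists h : real -> real,
    [/\ set_bij A B h,
        computable (graph A h)
      & computable (graph_inv (graph A h))].
Proof.
have [finv finvP] := preimage_choice A f.
have [ginv ginvP] := preimage_choice B g.
have [[pA pAP] [pB pBP]] := (sdA, sdB).
have [[pf pfP] [pg pgP]] := (f_comp, g_comp).
have [[pfi pfiP] [pgi pgiP]] := (finv_comp, ginv_comp).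
have [[pfr pfrP] [pgr pgrP]] := (f_ran, g_ran).
have finvK x : A x -> finv (f x) = x.
  move=> Ax; have [|Afx ffx] := finvP (f x); first by exists x.
  by apply: f_inj => //; apply/mem_set.
have ginvK y : B y -> ginv (g y) = y.
  move=> By; have [|Bgy ggy] := ginvP (g y); first by exists y.
  by apply: g_inj => //; apply/mem_set.
(* Side [true] is B and side [false] is A; [D s] consists of the points from which the chain can be
   followed one step back. *)
pose D s : set real := if s then f @` A else g @` B.
pose prev s : real -> real := if s then finv else ginv.
pose from_B := stops D prev true.
have testP s z : outputs (if s then pfr else pgr) z (char_fun (D s) z).
  by case: s; [apply/pfrP|apply/pgrP].
have prevP s z : D s z -> outputs (if s then pfi else pgi) z (prev s z).
  by case: s => Dz; [apply/pfiP/finvP|apply/pgiP/ginvP].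
(* Prepending [f x] to the chain of [x] does not change the side on which it stops. *)
have from_B_f x : A x -> from_B true (f x) <-> from_B false x.
  move=> Ax; have Dfx : D true (f x) by exists x.
  split=> [|Ex].
    move eqs : true => s; move eqz : (f x) => z st; case: st eqs eqz.
      by move=> z' nD _ e; case: nD; rewrite -e.
    by move=> s' z' _ + e1 e2; rewrite -e1 -e2 /prev finvK.
  by apply: (stops_back (s := true)) => //; rewrite /prev finvK.
have from_B_g y : B y -> from_B true y -> from_B false (g y).
  move=> By Ey; apply: (stops_back (s := false)); first by exists y.
  by rewrite /prev ginvK.
have from_BP x : from_B false x -> [/\ (g @` B) x & from_B true (ginv x)].
  move eqs : false => s st; case: st eqs => [//|s' z Dz + e].
  by rewrite -e in Dz *.
have onto_f y : ~ from_B true y -> (f @` A) y.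
  by move=> nEy; apply: contrapT => nfy; apply: nEy; apply: (@stops_here D prev true).
pose h x := if `[< from_B false x >] then ginv x else f x.
have hAB : set_fun A B h.
  move=> x Ax; rewrite /h; case: asboolP => [/from_BP[/ginvP[]//]|_].
  exact: fAB.
have h_inj : set_inj A h.
  (* A clash would make the chain of [x'] a tail of the chain of [x], so both would stop in B. *)
  have nclash x x' : A x' -> from_B false x -> ~ from_B false x' -> ginv x <> f x'.
    move=> Ax' /from_BP[_ Ex] nEx' e; apply: nEx'; apply/(from_B_f _ Ax').
    by rewrite -e.
  move=> x x' /set_mem Ax /set_mem Ax'; rewrite /h.
  case: asboolP => [Ex|nEx]; case: asboolP => [Ex'|nEx'] e.
  - have [/ginvP[_ gx] _] := from_BP _ Ex; have [/ginvP[_ gx'] _] := from_BP _ Ex'.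
    by rewrite -gx -gx' e.
  - by case: (nclash x x').
  - by case: (nclash x' x).
  - by apply: f_inj => //; apply/mem_set.
have h_g y : B y -> from_B true y -> h (g y) = y.
  by move=> By Ey; rewrite /h asboolT ?ginvK //; apply: from_B_g.
have h_finv y : ~ from_B true y -> h (finv y) = y.
  move=> nEy; have [Ay fy] := finvP y (onto_f y nEy).
  rewrite /h asboolF // => /(from_B_f _ Ay); by rewrite fy.
exists h; split.
- split=> // y By; case: (pselect (from_B true y)) => [Ey|nEy].
    by exists (g y); [apply: gBA|apply: h_g].
  by exists (finv y); [case: (finvP y (onto_f y nEy))|apply: h_finv].
- apply: (chain_computable (s0 := false) (p_final := fun s => if s then pgi else pf)
    pAP testP prevP) => [x Ax|x y []//].
  exists (h x) => [|y]; last by split=> [[]|].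
  rewrite /h -/from_B; case: asboolP => [/from_BP[gx _]|_].
    by apply/pgiP; apply: ginvP.
  by apply/pfP.
(* The inverse runs the same search from side B: y comes from [g y] if its chain stops in B, and
   from [finv y] otherwise. *)
- apply: (chain_computable (s0 := true) (p_final := fun s => if s then pg else pfi)
    pBP testP prevP) => [y By|y x [Ax <-]]; last exact: hAB.
  have uniq x : A x -> h x = y -> forall x', graph_inv (graph A h) y x' <-> x = x'.
    move=> Ax hx x'; split=> [[Ax' hx']|<-]; last by split.
    by apply: h_inj; rewrite ?hx //; apply/mem_set.
  rewrite -/from_B; case: asboolP => [Ey|nEy].
    exists (g y); first by apply/pgP.
    by apply: uniq; [apply: gBA|apply: h_g].
  have [Ay fy] := finvP y (onto_f y nEy).
  exists (finv y); first by apply/pfiP.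
  by apply: uniq => //; apply: h_finv.
Qed.
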